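(* Let $w\in\mathrm{Gr}_{\mathcal H_+}(\mathcal H)$ and $\mathbf n\in\mathbf A$. The ring homomorphism $\mathcal S\to(S^\times_{\mathbf x})^{-1}\mathbb C[[\mathbf x,\mathbf t]]$ defined by $\pi_\lambda\mapsto H^{\mathbf n,\lambda}_w$ for all partitions $\lambda$ annihilates $\mathcal I$, and hence induces a homomorphism of commutative algebras $$\Phi^{\mathbf n}_w:\mathcal S/\mathcal I\to(S^\times_{\mathbf x})^{-1}\mathbb C[[\mathbf x,\mathbf t]],\qquad \pi_\lambda\mapsto H^{\mathbf n,\lambda}_w.$$
   Context: Partitions and Frobenius notation: a partition $\lambda$ of Frobenius rank $r$ is written $\lambda=(a_1,\dots,a_r\mid b_1,\dots,b_r)$ with $a_1>\dots>a_r\ge 0$, $b_1>\dots>b_r\ge 0$, $a_i=\lambda_i-i$, $b_i=\lambda'_i-i$ ($\lambda'$ the conjugate partition); $\emptyset$ denotes the empty partition (rank $0$). Let $\mathcal S=\mathbb C[\pi_\lambda]$ be the polynomial ring in countably many indeterminates $\pi_\lambda$ indexed by all partitions $\lambda$. Plücker relations: for integers $0<k<N$ and a $k$-tuple $L=(L_1,\dots,L_k)$ of integers in $\{-k,\dots,N-k-1\}$ set $\tilde\pi_L:=\mathrm{sgn}(L)\,\pi_{\lambda(L)}$, where $\mathrm{sgn}(L)$ is the sign of the permutation sorting $L$ into increasing order ($\mathrm{sgn}(L):=0$ if $L$ has a repeated entry) and, if $L'_1<\dots<L'_k$ is the increasing rearrangement of $L$, $\lambda(L)$ is the partition with parts $\lambda_i=L'_{k-i+1}+i$,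 $i=1,\dots,k$. For a $(k-1)$-tuple $I$ and a $(k+1)$-tuple $J$ with entries in $\{-k,\dots,N-k-1\}$ the Plücker quadratic form is $p_{I,J}:=\sum_{j=1}^{k+1}(-1)^j\tilde\pi_{I_1,\dots,I_{k-1},J_j}\,\tilde\pi_{J_1,\dots,\widehat{J_j},\dots,J_{k+1}}\in\mathcal S$ (hat = omission). $\mathcal I\subset\mathcal S$ is the ideal generated by all $p_{I,J}$ for all $0<k<N$ and all such $I,J$. Points and $\tau$-functions: a point $w\in\mathrm{Gr}_{\mathcal H_+}(\mathcal H)$ is a family $(\pi_\lambda(w))_\lambda$ of complex numbers, not all zero, such that every element of $\mathcal I$ vanishes when each $\pi_\lambda$ is replaced by $\pi_\lambda(w)$. Its KP $\tau$-function is $\tau_w(\mathbf t)=\sum_\lambda\pi_\lambda(w)s_\lambda(\mathbf t)\in\mathbb C[[\mathbf t]]$, $\mathbf t=(t_1,t_2,\dots)$, where $s_\lambda(\mathbf t)$ is the Schur function written as a polynomial in $t_i=p_i/i$ ($p_i$ the power sums). Let $\mathbb C[[\mathbf x,\mathbf t]]$ be the ring of formal power series in indeterminates $x_i$ ($i\in\mathbb Z$) and $t_j$ ($j\ge1$), graded by $\deg x_i=1,\deg t_j=j$, and $(S^\times_{\mathbf x})^{-1}\mathbb C[[\mathbf x,\mathbf t]]$ its localization at the multiplicative set generated by all $x_i-x_j$, $i\neq j$. For $f\in\mathbb C[[\mathbf t]]$ and integers $n_i$ (finitely many nonzero), $f(\mathbf t+\sum_i n_i[x_i])$ denotes the substitution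 $t_j\mapsto t_j+\sum_in_ix_i^j/j$. $\mathbf A$ is the group of integer sequences $\mathbf n=(n_i)_{i\in\mathbb Z}$ with finitely many nonzero entries; $\boldsymbol\alpha_i\in\mathbf A$ is the $i$-th unit vector. Define $H^{\mathbf n}_w:=\prod_{i<j}(x_i-x_j)^{n_in_j}\,\tau_w(\mathbf t+\sum_in_i[x_i])$ and, for $\lambda=(a_1,\dots,a_r\mid b_1,\dots,b_r)$, $H^{\mathbf n,\lambda}_w:=H_w^{\mathbf n+\sum_{i=1}^r\boldsymbol\alpha_{a_i}-\sum_{i=1}^r\boldsymbol\alpha_{-b_i-1}}$ (so $H^{\mathbf n,\emptyset}_w=H^{\mathbf n}_w$). *)

(* Defs.v *)
From HB Require Import structures.
From mathcomp Require Import all_boot all_order all_algebra.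
From mathcomp Require Import reals Rstruct complex.
From mathcomp Require Import monalg.

Set Implicit Arguments.
Unset Strict Implicit.
Unset Printing Implicit Defensive.

Import Order.TTheory GRing.Theory Num.Theory.
Local Open Scope ring_scope.

Definition CC : numClosedFieldType := Rdefinitions.R[i].

Definition is_partition (l : seq nat) : bool :=
  sorted geq l && all (fun p => 0 < p)%N l.

(* lambda_i (1-based), 0 beyond the length *)
Definition part (l : seq nat) (i : nat) : nat := nth 0%N l i.-1.
Definition conj_part (l : seq nat) (i : nat) : nat := count (fun p => i <= p)%N l.
Definition frob_rank (l : seq nat) : nat :=
  \sum_(i < size l) (i.+1 <= nth 0%N l i)%N.
Definition frob_a (l : seq nat) (i : nat) : int := (part l i)%:Z - i%:Z.
Definition frob_b (l : seq nat) (i : nat) : int := (conj_part l i)%:Z - i%:Z.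

Definition var := (int + nat)%type.
Definition P := {malg CC[{cmonom var}]}.
Definition Xv (v : var) : P := << ucm v >>.
Definition xvar (i : int) : P := Xv (inl i).
Definition tvar (j : nat) : P := Xv (inr j).
Definition vdeg (v : var) : nat := match v with inl _ => 1%N | inr j => j end.

(* Schur functions as polynomials in t_j = p_j / j, evaluated at an    *)
(* arbitrary family tt : nat -> P (tt j is the value given to t_j).    *)
(* h_k = coefficient of z^k in exp(sum_{j>=1} t_j z^j)                 *)
(*     = sum over (m_1,...,m_k) with sum_j j m_j = k of                *)
(*       prod_j t_j^{m_j} / m_j!                                       *)
Definition hcomp (tt : nat -> P) (k : nat) : P :=
  \sum_(f : {ffun 'I_k -> 'I_k.+1} | (\sum_(j < k) j.+1 * f j)%N == k)
     \prod_(j < k) ((((f j)`!%:R)^-1 : CC) *: tt j.+1 ^+ f j).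
Definition hz (tt : nat -> P) (z : int) : P :=
  match z with Posz k => hcomp tt k | Negz _ => 0 end.
Definition schur (l : seq nat) (tt : nat -> P) : P :=
  \det (\matrix_(i < size l, j < size l)
          hz tt ((nth 0%N l i)%:Z - i%:Z + j%:Z)).

(* The ring C[[x,t]] (graded completion).  An element is represented  *)
(* by its sequence of homogeneous components: F d is the component of  *)
(* weighted degree d.  All elements built below have F d homogeneous   *)
(* of degree d, and the operations are those of C[[x,t]].              *)
Definition PS := nat -> P.
Definition psadd (F G : PS) : PS := fun d => F d + G d.
Definition psmul (F G : PS) : PS := fun d => \sum_(k < d.+1) F k * G (d - k)%N.
Definition psone : PS := fun d => if d == 0%N then 1 else 0.
Definition pszero : PS := fun _ => 0.
Definition psscale (c : CC) (F : PS) : PS := fun d => c *: F d.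
Definition psvar (v : var) : PS := fun d => if d == vdeg v then Xv v else 0.
Definition psexp (F : PS) (e : nat) : PS := iter e (psmul F) psone.
Definition psprod (s : seq PS) : PS := foldr psmul psone s.
Definition pseq0 (F : PS) : Prop := forall d, F d = 0.

Definition psdiff (p : int * int) : PS :=
  psadd (psvar (inl p.1)) (psscale (-1) (psvar (inl p.2))).

(* Partitions of d: nonincreasing padded sequences of length d with    *)
(* sum d, zeros stripped (bijective with partitions of d).             *)
Definition padseq d (f : {ffun 'I_d -> 'I_d.+1}) : seq nat :=
  [seq nat_of_ord (f i) | i <- enum 'I_d].
Definition is_pad d (f : {ffun 'I_d -> 'I_d.+1}) : bool :=
  sorted geq (padseq f) && (sumn (padseq f) == d).
Definition strip d (f : {ffun 'I_d -> 'I_d.+1}) : seq nat :=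
  [seq p <- padseq f | (0 < p)%N].

(* Elements of A = integer sequences (n_i)_{i in Z} with finite        *)
(* support; a function n : int -> int together with a list Sn such     *)
(* that n i = 0 outside Sn.                                            *)
(* tau_w(t + sum_i m_i [x_i]) : component of degree d is               *)
(*   sum_{|lambda| = d} pi_lambda s_lambda(t_j + sum_i m_i x_i^j / j). *)
Definition shifted_t (m : int -> int) (U : seq int) (j : nat) : P :=
  tvar j + \sum_(i <- undup U) (((m i)%:~R / j%:R : CC) *: xvar i ^+ j).
Definition tau_shift (pi : seq nat -> CC) (m : int -> int) (U : seq int) : PS :=
  fun d => \sum_(f : {ffun 'I_d -> 'I_d.+1} | is_pad f)
             pi (strip f) *: schur (strip f) (shifted_t m U).

(* The localization (S_x^x)^{-1} C[[x,t]]: a fraction is a numerator   *)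
(* in C[[x,t]] and a denominator given as a list of pairs (i,j),       *)
(* standing for prod (x_i - x_j).                                      *)
Record frac := Frac { fnum : PS; fden : seq (int * int) }.
Definition Dprod (s : seq (int * int)) : PS := psprod (map psdiff s).
Definition fadd (a b : frac) : frac :=
  Frac (psadd (psmul (fnum a) (Dprod (fden b))) (psmul (fnum b) (Dprod (fden a))))
       (fden a ++ fden b).
Definition fmul (a b : frac) : frac :=
  Frac (psmul (fnum a) (fnum b)) (fden a ++ fden b).
Definition fscale (c : CC) (a : frac) : frac := Frac (psscale c (fnum a)) (fden a).
Definition fzero_el : frac := Frac pszero [::].
(* a/d = 0 in the localization iff s a = 0 for some s in the           *)
(* multiplicative set generated by the x_i - x_j, i <> j.              *)
Definition fzero (a : frac) : Prop :=
  exists s : seq (int * int),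
    all (fun p => p.1 != p.2) s /\ pseq0 (psmul (Dprod s) (fnum a)).

(* H^m_w = prod_{i<j} (x_i - x_j)^{m_i m_j} tau_w(t + sum_i m_i [x_i]),   *)
(* as an element of the localization; U is a list containing the       *)
(* support of m.                                                        *)
Definition pairs_of (U : seq int) : seq (int * int) :=
  [seq p <- [seq (i, j) | i <- undup U, j <- undup U] | p.1 < p.2].
Definition Hfrac (pi : seq nat -> CC) (m : int -> int) (U : seq int) : frac :=
  Frac (psmul (psprod [seq psexp (psdiff p) (absz (Num.max 0 (m p.1 * m p.2))%R)
                          | p <- pairs_of U])
              (tau_shift pi m U))
       (flatten [seq nseq (absz (Num.min 0 (m p.1 * m p.2))%R) p | p <- pairs_of U]).

Definition shift_frob (n : int -> int) (l : seq nat) : int -> int :=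
  fun z => n z + \sum_(1 <= i < (frob_rank l).+1)
                   (((z == frob_a l i) : int) - ((z == - frob_b l i - 1) : int)).
Definition frob_supp (l : seq nat) : seq int :=
  [seq frob_a l i | i <- iota 1 (frob_rank l)] ++
  [seq - frob_b l i - 1 | i <- iota 1 (frob_rank l)].
Definition Hnl (pi : seq nat -> CC) (n : int -> int) (Sn : seq int) (l : seq nat) : frac :=
  Hfrac pi (shift_frob n l) (Sn ++ frob_supp l).

Definition inversions (L : seq int) : nat :=
  \sum_(a < size L) \sum_(b < size L)
     ((a < b)%N && (nth (0:int) L b < nth (0:int) L a)%R)%N.
Definition sgnL (L : seq int) : int :=
  if uniq L then (-1) ^+ inversions L else 0.
Definition lamL (L : seq int) : seq nat :=
  let L' := sort <=%R L in
  let k := size L in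
  [seq p <- [seq absz (nth (0:int) L' (k - i.+1)%N + i.+1%:Z) | i <- iota 0 k] | (0 < p)%N].

Definition in_range (k N : nat) (z : int) : bool :=
  (- k%:Z <= z) && (z <= N%:Z - k%:Z - 1).

(* p_{I,J} = sum_{j=1}^{k+1} (-1)^j ~pi_{I,J_j} ~pi_{J \ J_j}: the list of  *)
(* its terms  (coefficient, lambda, mu) standing for coeff * pi_lambda pi_mu. *)
Definition plucker_terms (I J : seq int) : seq (int * seq nat * seq nat) :=
  [seq let L1 := rcons I (nth (0:int) J j) in
       let L2 := take j J ++ drop j.+1 J in
       ((-1) ^+ j.+1 * sgnL L1 * sgnL L2, lamL L1, lamL L2)
  | j <- iota 0 (size J)].

Definition plucker_ok (k N : nat) (I J : seq int) : bool :=
  [&& (0 < k)%N, (k < N)%N, size I == k.-1, size J == k.+1,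
      all (in_range k N) I & all (in_range k N) J].

Definition plucker_C (pi : seq nat -> CC) (I J : seq int) : CC :=
  \sum_(t <- plucker_terms I J) t.1.1%:~R * pi t.1.2 * pi t.2.

(* points of Gr_{H_+}(H): families (pi_lambda) indexed by partitions,   *)
(* not all zero, annihilated by the Plucker ideal (equivalently, by its *)
(* generators p_{I,J}).  Values of pi on non-partitions are irrelevant. *)
Definition is_point (pi : seq nat -> CC) : Prop :=
  (exists l, is_partition l /\ pi l != 0) /\
  (forall k N I J, plucker_ok k N I J -> plucker_C pi I J = 0).

Definition plucker_H (pi : seq nat -> CC) (n : int -> int) (Sn : seq int)
    (I J : seq int) : frac :=
  foldr (fun t acc => fadd (fscale t.1.1%:~R (fmul (Hnl pi n Sn t.1.2)
                                                  (Hnl pi n Sn t.2))) acc)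
        fzero_el (plucker_terms I J).

(* Main.v *)
Require Import Defs.
From mathcomp Require Import all_boot all_order all_algebra all_fingroup.
From mathcomp Require Import reals Rstruct complex.
From mathcomp Require Import monalg.
From mathcomp Require Import ring zify.

Set Implicit Arguments.
Unset Strict Implicit.
Unset Printing Implicit Defensive.

Import Order.TTheory GRing.Theory Num.Theory.
Local Open Scope ring_scope.

(** The exponent vector attached to the partition of [L] is
    [n + sum_i alpha_(a_i) - sum_i alpha_(-b_i-1) = c + 1_L], where
    [c = n - 1_[-k,-1]] does not depend on [L].  In a Plucker term the exponent
    of [x_i - x_j] is therefore an amount common to all the terms plus
    [e_i e_j + e'_i e'_j], with [e, e'] the indicators of the two index tuples,
    and the sign of a tuple turns the sorted product of differences into the
    Vandermonde product of the unsorted tuple.  What remains is the multi-Fay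
    identity
    [sum_j (-1)^j Delta(x_I,x_Jj) tau(t' + [x_I] + [x_Jj])
                  Delta(x_J\Jj) tau(t' + [x_J\Jj]) = 0].

    By Jacobi-Trudi and column operations, [Delta(x_L) tau(t' + [x_L])] is, up to
    a sign depending only on the length of [L], the pairing of the point [pi]
    with a wedge of [k] vectors, one for each [x] in [x_L] and depending only on
    [x] and [t'], and of [D] vectors depending only on [t'].  The identity is
    then the multilinear extension of a Plucker relation of [pi] between minors
    of size [D + k]; the terms that repeat one of the [D] vectors vanish.

    Identities between power series are checked up to degree [D], in [{poly P}],
    where the power of ['X] records the degree. *)

(** * Multilinear sums over words in a finite alphabet *)

Section Words.
Variable R : comNzRingType.
Implicit Types (W : nat) (vs us : seq (nat -> R)) (F G : seq nat -> R).

(** The multilinear extension of [F]: its value on the tensor product of the vectors [vs], cut to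
    their first [W] coordinates, when [F l] is the value on the basis tensor of the word [l]. *)
Fixpoint wsum W vs F : R :=
  if vs is v :: vs' then \sum_(B < W) v B * wsum W vs' (fun l => F (val B :: l))
  else F [::].

Lemma eq_wsum W vs F G :
  (forall l, size l = size vs -> all (fun B => B < W)%N l -> F l = G l) ->
  wsum W vs F = wsum W vs G.
Proof.
elim: vs F G => [|v vs IH] F G eqFG /=; first exact: eqFG.
apply: eq_bigr => B _; congr (_ * _); apply: IH => l sl al.
by apply: eqFG => /=; rewrite ?sl ?ltn_ord.
Qed.

Lemma wsum_cat W us vs F :
  wsum W (us ++ vs) F = wsum W us (fun a => wsum W vs (fun b => F (a ++ b))).
Proof.
by elim: us F => //= u us IH F; apply: eq_bigr => B _; rewrite IH.
Qed.

Lemma wsum_sum W vs (J : Type) (s : seq J) (F : J -> seq nat -> R) :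
  wsum W vs (fun l => \sum_(j <- s) F j l) = \sum_(j <- s) wsum W vs (F j).
Proof.
elim: vs F => //= v vs IH F; rewrite exchange_big; apply: eq_bigr => B _ /=.
by rewrite IH mulr_sumr.
Qed.

Lemma wsumZ W vs c F : wsum W vs (fun l => c * F l) = c * wsum W vs F.
Proof.
elim: vs F => //= v vs IH F; rewrite mulr_sumr; apply: eq_bigr => B _ /=.
by rewrite IH mulrCA.
Qed.

Lemma wsum_mul W us vs F G :
  wsum W us F * wsum W vs G = wsum W us (fun a => wsum W vs (fun b => F a * G b)).
Proof.
rewrite [RHS](@eq_wsum _ _ _ (fun a => wsum W vs G * F a)).
  by rewrite wsumZ mulrC.
by move=> l _ _; rewrite wsumZ mulrC.
Qed.

(** Each vector of [us] and [vs] occurs exactly once in the two factors, so both sums merge into one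
    sum over a pair of words, in which only the letter at place [j] of the second word has moved. *)
Lemma wsum_plucker_term W us vs F v0 j : (j < size vs)%N ->
  wsum W (rcons us (nth v0 vs j)) F * wsum W (take j vs ++ drop j.+1 vs) F =
  wsum W us (fun a => wsum W vs (fun b =>
     F (rcons a (nth 0%N b j)) * F (take j b ++ drop j.+1 b))).
Proof.
move=> ltj; rewrite wsum_mul -cats1 wsum_cat.
apply: eq_wsum => a _ _ /=.
rewrite -[vs in RHS](cat_take_drop j) (drop_nth v0 ltj) wsum_cat /=.
rewrite (eq_bigr (fun B : 'I_W => wsum W (take j vs) (fun b1 =>
    nth v0 vs j B * wsum W (drop j.+1 vs) (fun b2 =>
       F (a ++ [:: val B]) * F (b1 ++ b2))))); last first.
  by move=> B _; rewrite wsum_cat -wsumZ.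
rewrite -wsum_sum; apply: eq_wsum => b1.
rewrite size_take ltj => sb1 _.
apply: eq_bigr => B _; congr (_ * _).
apply: eq_wsum => b2 _ _.
rewrite nth_cat take_cat drop_cat sb1 ltnn ltnNge leqnSn /= subnn /= subSnn /=.
by rewrite drop0 cats0 cats1.
Qed.

(** Every term is linear in each vector, so a quadratic relation that holds on basis vectors, with
    coefficients independent of the words, extends to all vectors. *)
Lemma wsum_plucker W us vs F v0 (c : nat -> R) :
  (forall a b, size a = size us -> size b = size vs ->
     all (fun B => B < W)%N a -> all (fun B => B < W)%N b ->
     \sum_(j <- iota 0 (size vs)) c j *
       (F (rcons a (nth 0%N b j)) * F (take j b ++ drop j.+1 b)) = 0) ->
  \sum_(j <- iota 0 (size vs)) c j *
     (wsum W (rcons us (nth v0 vs j)) F * wsum W (take j vs ++ drop j.+1 vs) F) = 0.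
Proof.
move=> H.
rewrite big_seq (eq_bigr (fun j => wsum W us (fun a => wsum W vs (fun b =>
    c j * (F (rcons a (nth 0%N b j)) * F (take j b ++ drop j.+1 b)))))); last first.
  move=> j; rewrite mem_iota add0n => /= ltj.
  rewrite wsum_plucker_term // -wsumZ; apply: eq_wsum => a _ _.
  by rewrite wsumZ.
(* The vanishing summand is written [0 * 0] so that [wsumZ] takes out a zero factor. *)
rewrite -big_seq -wsum_sum (@eq_wsum _ _ _ (fun=> 0 * 0)) ?wsumZ ?mul0r //.
move=> a sa aa; rewrite -wsum_sum (@eq_wsum _ _ _ (fun=> 0 * 0)) ?wsumZ ?mul0r //.
by move=> b sb ab; apply: H.
Qed.

Fixpoint words W n : seq (seq nat) :=
  if n is n'.+1 then [seq B :: l | B <- iota 0 W, l <- words W n'] else [:: [::]].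

Lemma mem_words W n l :
  (l \in words W n) = (size l == n) && all (fun B => B < W)%N l.
Proof.
elim: n l => [|n IH] l; first by case: l.
apply/allpairsP/idP => [[[B l'] /= [inB inl ->]]|].
  by move: inB inl; rewrite IH mem_iota add0n /= eqSS => -> /andP[-> ->].
case: l => [|B l] //=; rewrite eqSS => /and3P[sl ltB al].
by exists (B, l); rewrite mem_iota IH sl al ltB.
Qed.

Lemma words_uniq W n : uniq (words W n).
Proof.
elim: n => //= n IH; apply: allpairs_uniq => //; first exact: iota_uniq.
by move=> [B l] [B' l'] _ _ /= [-> ->].
Qed.

Lemma wsumE W vs F v0 :
  wsum W vs F = \sum_(l <- words W (size vs))
    (\prod_(a < size vs) (nth v0 vs a) (nth 0%N l a)) * F l.
Proof.
elim: vs F => [|v vs IH] F /=; first by rewrite big_seq1 big_ord0 mul1r.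
rewrite big_allpairs_dep /= -[in iota _ _](subn0 W) -/(index_iota 0 W) big_mkord.
apply: eq_bigr => B _; rewrite IH mulr_sumr; apply: eq_bigr => l _.
by rewrite big_ord_recl /= mulrA.
Qed.

Definition permw n (S : seq nat) (s : 'S_n) : seq nat :=
  [seq nth 0%N S (s i) | i <- enum 'I_n].

Lemma nth_permw n S (s : 'S_n) (i : 'I_n) : nth 0%N (permw S s) i = nth 0%N S (s i).
Proof. by rewrite (nth_map i) ?size_enum_ord // nth_ord_enum. Qed.

Lemma perm_permw n S (s : 'S_n) : size S = n -> perm_eq (permw S s) S.
Proof.
move=> sS; apply/(perm_iotaP 0%N); exists [seq val (s i) | i <- enum 'I_n].
  rewrite sS -val_enum_ord (map_comp val s); apply: perm_map.
  apply: uniq_perm; [|exact: enum_uniq|].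
    by rewrite (map_inj_uniq perm_inj) enum_uniq.
  move=> i; rewrite mem_enum; apply/mapP; exists (s^-1%g i); rewrite ?mem_enum //.
  by rewrite permKV.
by rewrite -map_comp.
Qed.

(** A word with distinct letters determines its increasing rearrangement and the permutation between
    the two, so a sum over such words becomes a double sum of Leibniz type. *)
Lemma words_permw W n :
  perm_eq [seq l <- words W n | uniq l]
    [seq permw w s | w <- [seq w <- words W n | sorted ltn w], s <- enum [set: 'S_n]].
Proof.
apply: uniq_perm; first by rewrite filter_uniq ?words_uniq.
  apply: allpairs_uniq; [by rewrite filter_uniq ?words_uniq|exact: enum_uniq|].
  move=> [S s] [S' s'] /allpairsP[[a b] /= [+ _ [-> ->]]] /allpairsP[[a' b'] /= [+ _ [-> ->]]].
  rewrite !mem_filter !mem_words => /and3P[sa /eqP za _] /and3P[sa' /eqP za' _] {S s S' s'} E.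
  have eqa : a = a'.
    apply: (@irr_sorted_eq _ ltn) => //; [exact: ltn_trans|exact: ltnn|].
    by apply: perm_mem; rewrite -(permPl (perm_permw b za)) E perm_permw.
  rewrite -eqa in E *; congr (_, _); apply/permP => i; apply/val_inj/eqP => /=.
  rewrite -(@nth_uniq _ 0%N a) ?za ?ltn_ord //.
    by rewrite -!nth_permw E.
  exact: (sorted_uniq ltn_trans ltnn).
move=> l; rewrite mem_filter mem_words; apply/idP/allpairsP => [|[[S s] /= [+ _ ->]]].
  case/and3P => ul /eqP sl al; pose S := sort leq l.
  have pS : perm_eq l S by rewrite perm_sym perm_sort.
  have sS : size S = n by rewrite size_sort.
  (* [Is] lists the places in [S] of the letters of [l]; read as a function, it is the permutation
     sought. *)
  have /(perm_iotaP 0%N)[Is pIs El] := pS.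
  have sIs : size Is = n by rewrite (perm_size pIs) size_iota sS.
  have uIs : uniq Is by rewrite (perm_uniq pIs) iota_uniq.
  have ltIs (i : 'I_n) : (nth 0%N Is i < n)%N.
    have : nth 0%N Is i \in Is by rewrite mem_nth // sIs.
    by rewrite (perm_mem pIs) mem_iota sS.
  have injf : injective (fun i : 'I_n => Ordinal (ltIs i)).
    move=> i j [] /eqP; rewrite nth_uniq ?sIs // => /eqP; exact: val_inj.
  exists (S, perm injf); rewrite mem_filter mem_words sS eqxx mem_enum in_setT /=.
  split=> //.
    rewrite ltn_sorted_uniq_leq sort_uniq ul sort_sorted /=; last exact: leq_total.
    by rewrite -(perm_all _ pS).
  apply: (@eq_from_nth _ 0%N); first by rewrite size_map size_enum_ord.
  rewrite sl => i lti; rewrite (nth_permw _ _ (Ordinal lti)) permE /= {1}El.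
  by rewrite (nth_map 0%N) // sIs.
rewrite mem_filter mem_words => /and3P[sS /eqP zS aS].
have pS := perm_permw s zS.
rewrite (perm_uniq pS) (perm_all _ pS) (perm_size pS) aS zS eqxx !andbT.
exact: (sorted_uniq ltn_trans ltnn).
Qed.

(** Words with a repetition contribute nothing. The others are grouped by their increasing
    rearrangement [S], and the sum over permutations is the Leibniz formula for the minor of [vs]
    with rows [S]. *)
Lemma wsum_alternating W vs F v0 (n := size vs) :
  (forall l, ~~ uniq l -> F l = 0) ->
  (forall S (s : 'S_n), sorted ltn S -> size S = n -> F (permw S s) = (-1) ^+ s * F S) ->
  wsum W vs F = \sum_(S <- words W n | sorted ltn S)
     F S * \det (\matrix_(i < n, j < n) (nth v0 vs j) (nth 0%N S i)).
Proof.
move=> F0 Fs; rewrite (wsumE _ _ _ v0) -/n.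
rewrite (bigID uniq) /= [X in _ + X]big1 ?addr0; last by move=> l /F0 ->; rewrite mulr0.
rewrite -big_filter (perm_big _ (words_permw W n)) big_allpairs_dep /= big_filter.
rewrite big_seq_cond [RHS]big_seq_cond.
apply: eq_bigr => S /andP[]; rewrite mem_words => /andP[/eqP sS aS] soS.
rewrite -det_tr big_enum mulr_sumr /=.
apply: eq_big => [s|s _]; first by rewrite in_setT.
rewrite Fs // mulrC -mulrA mulrCA; congr (_ * (_ * _)).
by apply: eq_bigr => i _; rewrite !mxE nth_permw.
Qed.

End Words.

(** * Signs of tuples and products over ordered pairs *)

Section Sign.

Definition pairprod (R : comNzRingType) (g : int -> int -> R) (L : seq int) : R :=
  \prod_(i <- L) \prod_(j <- L | i < j) g i j.

Lemma perm_pairprod (R : comNzRingType) (g : int -> int -> R) L L' :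
  perm_eq L L' -> pairprod g L = pairprod g L'.
Proof.
move=> pL; rewrite /pairprod (perm_big _ pL); apply: eq_bigr => i _.
exact: perm_big.
Qed.

(** The left side orders pairs by position and [pairprod] orders them by value; the two factors of a
    pair differ by a sign exactly when the pair is an inversion. *)
Lemma prod_sgnL (R : comNzRingType) (g : int -> int -> R) (L : seq int) :
  (forall i j, g j i = - g i j) -> uniq L ->
  \prod_(a < size L) \prod_(b < size L | (a < b)%N) g (nth (0 : int) L a) (nth (0 : int) L b)
  = (sgnL L)%:~R * pairprod g L.
Proof.
move=> gN uL; rewrite /sgnL uL /pairprod; set n := size L.
pose x (a : 'I_n) := nth (0 : int) L a.
have -> : \prod_(i <- L) \prod_(j <- L | i < j) g i j =
    \prod_(a < n) \prod_(b < n | x a < x b) g (x a) (x b).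
  rewrite (big_nth 0) big_mkord; apply: eq_bigr => a _.
  by rewrite (big_nth 0) big_mkord.
have -> : \prod_(a < n) \prod_(b < n | x a < x b) g (x a) (x b) =
    \prod_(a < n) \prod_(b < n | (a < b)%N)
       (if x b < x a then g (x b) (x a) else g (x a) (x b)).
  rewrite (eq_bigr (fun a : 'I_n =>
     (\prod_(b < n | (x a < x b) && (a < b)%N) g (x a) (x b)) *
     (\prod_(b < n | (x a < x b) && ~~ (a < b)%N) g (x a) (x b)))); last first.
    by move=> a _; rewrite (bigID (fun b : 'I_n => (a < b)%N)).
  rewrite big_split /=.
  rewrite [X in _ * X](eq_bigr (fun a : 'I_n =>
      \prod_(b < n) if (x a < x b) && ~~ (a < b)%N then g (x a) (x b) else 1)); last first.
    by move=> a _; rewrite big_mkcond.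
  (* Exchanging the two indices turns the pairs that [L] lists in decreasing order into pairs of
     increasing positions. *)
  rewrite [X in _ * X]exchange_big -big_split; apply: eq_bigr => a _ /=.
  rewrite -[X in _ * X]big_mkcond /=.
  rewrite [RHS](bigID (fun b : 'I_n => x b < x a)) /= mulrC; congr (_ * _).
    apply: eq_big => [b|b /andP[-> _]//].
    rewrite andbC; case: ltP => //; rewrite ?andbF // => xba; rewrite !andbT.
    rewrite -leqNgt leq_eqVlt; case: eqP => // eqab; move: xba.
    by rewrite (val_inj eqab) ltxx.
  apply: eq_big => [b|b /andP[xab _]]; last by rewrite ltNge (ltW xab).
  rewrite andbC; case: (ltnP a b) => //= ltab.
  rewrite -leNgt [RHS]le_eqVlt /x nth_uniq ?ltn_ord //.
  by rewrite (ltn_eqF ltab).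
rewrite -[(_ ^+ _)%:~R]/(_) rmorphXn /= rmorphN1 /inversions.
rewrite -prodrXr -big_split; apply: eq_bigr => a _ /=.
rewrite -prodrXr big_mkcond [X in _ * X]big_mkcond -big_split.
apply: eq_bigr => b _ /=; rewrite -/n -/(x a) -/(x b).
case: (a < b)%N; rewrite ?expr0 ?mulr1 //=.
by case: (x b < x a); rewrite ?expr1 ?expr0 ?mul1r // mulN1r gN.
Qed.

(** A repetition produces a factor [g i i] on the left and a zero sign on the right. *)
Lemma prod_sgnL0 (R : comNzRingType) (g : int -> int -> R) (L : seq int) :
  (forall i j, g j i = - g i j) -> (forall i, g i i = 0) ->
  \prod_(a < size L) \prod_(b < size L | (a < b)%N) g (nth (0 : int) L a) (nth (0 : int) L b)
  = (sgnL L)%:~R * pairprod g L.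
Proof.
move=> gN g0; have [uL|uL] := boolP (uniq L); first exact: prod_sgnL.
rewrite /sgnL (negbTE uL) mul0r.
have /(uniqPn (0 : int))[a [b [ab bL Eab]]] := uL.
rewrite (bigD1 (Ordinal (ltn_trans ab bL))) //= (bigD1 (Ordinal bL)) //=.
by rewrite Eab g0 !mul0r.
Qed.

(** By [prod_sgnL], a Vandermonde determinant with distinct integer nodes is [sgnL] times a nonzero
    product that ignores their order. Permuting the columns multiplies it by the sign of [s], and
    the product cancels. *)
Lemma sgnL_perm n (M : seq int) (s : 'S_n) (M' := [seq nth (0 : int) M (s i) | i <- enum 'I_n]) :
  size M = n -> perm_eq M' M -> sgnL M' = (-1) ^+ s * sgnL M.
Proof.
move=> sM pM; have sM' : size M' = n by rewrite size_map size_enum_ord.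
have [uM|uM] := boolP (uniq M); last first.
  by rewrite /sgnL (perm_uniq pM) (negbTE uM) mulr0.
have uM' : uniq M' by rewrite (perm_uniq pM).
pose g (i j : int) : int := j - i.
have gN i j : g j i = - g i j by rewrite /g opprB.
have nthM' (i : 'I_n) : nth (0 : int) M' i = nth (0 : int) M (s i).
  by rewrite (nth_map i) ?size_enum_ord // nth_ord_enum.
have V (K : seq int) : size K = n -> uniq K ->
    \det (Vandermonde n (\row_(i < n) nth (0 : int) K i)) = sgnL K * pairprod g K.
  move=> sK uK; rewrite det_Vandermonde.
  transitivity ((sgnL K)%:~R * pairprod g K); last by rewrite intz.
  rewrite -prod_sgnL // sK; apply: eq_bigr => a _; apply: eq_bigr => b _.
  by rewrite !mxE.
have Q0 : pairprod g M != 0.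
  rewrite /pairprod prodf_seq_neq0; apply/allP => i _ /=.
  rewrite prodf_seq_neq0; apply/allP => j _; apply/implyP => ltij.
  by rewrite subr_eq0 gt_eqF.
apply: (mulIf Q0); rewrite -mulrA -V // -(perm_pairprod _ pM) -V //.
have -> : Vandermonde n (\row_(i < n) nth (0 : int) M' i) =
    col_perm s (Vandermonde n (\row_(i < n) nth (0 : int) M i)).
  by apply/matrixP => i j; rewrite !mxE nthM'.
by rewrite col_permE det_mulmx det_perm odd_permV mulrC.
Qed.

End Sign.

(** * Plucker coordinates as an alternating function of words *)

Section Plucker.
Variables (R : comNzRingType) (emb : {rmorphism CC -> R}) (pi : seq nat -> CC).
Implicit Types (vs us : seq (nat -> R)).

(** Sends the letters [0, ..., W - 1] to [-r, ..., W - r - 1], the range of entries of the Plucker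
    relations with [k = r] and [N = W]. *)
Definition wshift (r : nat) (l : seq nat) : seq int := [seq B%:Z - r%:Z | B <- l].

Lemma wshift_inj r : injective (fun B : nat => B%:Z - r%:Z).
Proof. by move=> B C /addIr []. Qed.

Lemma lamL_perm L L' : perm_eq L L' -> lamL L = lamL L'.
Proof.
move=> pL; rewrite /lamL (perm_size pL).
by have /(perm_sortP le_total le_trans le_anti) -> := pL.
Qed.

Lemma sgnL_sorted L : sorted <%R L -> sgnL L = 1.
Proof.
move=> sL; have uL : uniq L by exact: (sorted_uniq lt_trans ltxx).
rewrite /sgnL uL /inversions big1 // => a _; rewrite big1 // => b _.
case: ltnP => //= ltab; suff -> : (nth (0 : int) L b < nth (0 : int) L a) = false by [].
apply/negbTE; rewrite -leNgt ltW //.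
by apply: (sorted_ltn_nth lt_trans) => //; rewrite inE ltn_ord.
Qed.

Lemma wshift_sorted r S : sorted ltn S -> sorted <%R (wshift r S).
Proof.
move=> sS; rewrite sorted_map; apply: sub_sorted sS => a b /= ab; lia.
Qed.

Definition plucker_coord (r : nat) (l : seq nat) : R :=
  emb ((sgnL (wshift r l))%:~R * pi (lamL (wshift r l))).

(** This is the pairing of [pi] with the wedge of [vs], expanded in maximal minors: an alternating
    function is known from its values on increasing words, where the sign is 1. *)
Lemma wsum_plucker_coord W vs v0 (r := size vs) :
  wsum W vs (plucker_coord r) = \sum_(S <- words W r | sorted ltn S)
     emb (pi (lamL (wshift r S))) *
     \det (\matrix_(i < r, j < r) (nth v0 vs j) (nth 0%N S i)).
Proof.
rewrite (wsum_alternating _ v0).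
- apply: eq_bigr => S sS; congr (_ * _).
  by rewrite /plucker_coord sgnL_sorted ?mul1r // wshift_sorted.
- move=> l ul; rewrite /plucker_coord /sgnL (map_inj_uniq (@wshift_inj r)) (negbTE ul).
  by rewrite mul0r rmorph0.
- move=> S s sS zS; rewrite /plucker_coord.
  have pS : perm_eq (wshift r (permw S s)) (wshift r S).
    by apply: perm_map; apply: perm_permw.
  rewrite (lamL_perm pS).
  have E : wshift r (permw S s) = [seq nth (0 : int) (wshift r S) (s i) | i <- enum 'I_r].
    rewrite /wshift -map_comp; apply: eq_map => i /=.
    by rewrite (nth_map 0%N) ?zS ?ltn_ord.
  rewrite E sgnL_perm ?size_map // -?E //.
  by rewrite intrM -mulrA rmorphM rmorph_int rmorphXn rmorphN1.
Qed.

Lemma wsum_plucker_coordE W vs v0 r : size vs = r ->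
  wsum W vs (plucker_coord r) = \sum_(S <- words W r | sorted ltn S)
     emb (pi (lamL (wshift r S))) *
     \det (\matrix_(i < r, j < r) (nth v0 vs j) (nth 0%N S i)).
Proof. by move=> <-; exact: wsum_plucker_coord. Qed.

(** Every minor in the expansion has two equal columns. *)
Lemma wsum_plucker_coord_dup W vs v0 a b r : size vs = r ->
  (a < b < r)%N -> nth v0 vs a = nth v0 vs b -> wsum W vs (plucker_coord r) = 0.
Proof.
move=> <- /andP[ltab ltb] eqab; rewrite (wsum_plucker_coord _ _ v0) big1 // => S _.
have lta := ltn_trans ltab ltb.
rewrite -det_tr (@determinant_alternate _ _ _ (Ordinal lta) (Ordinal ltb)) ?mulr0 //.
  by rewrite -val_eqE /= ltn_eqF.
by move=> i; rewrite !mxE /= eqab.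
Qed.

(** On basis vectors this is the relation p_{I,J} with [k = r] and [N = W]; [wsum_plucker] extends
    it. *)
Lemma wsum_plucker_relation W r us vs v0 :
  (forall k N I J, plucker_ok k N I J -> plucker_C pi I J = 0) ->
  (0 < r < W)%N -> size us = r.-1 -> size vs = r.+1 ->
  \sum_(j <- iota 0 r.+1) (-1) ^+ j.+1 *
     (wsum W (rcons us (nth v0 vs j)) (plucker_coord r) *
      wsum W (take j vs ++ drop j.+1 vs) (plucker_coord r)) = 0.
Proof.
move=> Hpi /andP[r0 rW] sus svs; rewrite -svs.
apply: wsum_plucker => a b sa sb aa ab.
have inr l : all (fun B : nat => (B < W)%N) l -> all (in_range r W) (wshift r l).
  by rewrite all_map; apply: sub_all => B /=; rewrite /in_range => ltB; lia.
have := Hpi r W (wshift r a) (wshift r b).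
rewrite /plucker_ok r0 rW !size_map sa sb sus svs !eqxx !inr // => /(_ isT).
move=> /(congr1 emb); rewrite rmorph0 => E; rewrite -[RHS]E.
rewrite /plucker_C /plucker_terms big_map size_map sb svs rmorph_sum.
rewrite big_seq [RHS]big_seq; apply: eq_bigr => j; rewrite mem_iota add0n => /= ltj.
rewrite /plucker_coord /wshift !map_rcons !map_cat map_take map_drop.
rewrite (nth_map 0%N) ?sb ?svs //.
rewrite !(rmorphM, rmorph_int, rmorphXn, rmorphN1) /=.
ring.
Qed.

End Plucker.

(** * Polynomials modulo ['X^W] *)

Section Truncation.
Variable R : comNzRingType.
Implicit Types p q : {poly R}.

Definition eqmodX W p q := forall i, (i < W)%N -> p`_i = q`_i.

Lemma eqmodX_refl W p : eqmodX W p p. Proof. by []. Qed.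

Lemma eqmodX_trans W p q s : eqmodX W p q -> eqmodX W q s -> eqmodX W p s.
Proof. by move=> H1 H2 i Hi; rewrite H1 ?H2. Qed.

Lemma eqmodXD W p q p' q' : eqmodX W p p' -> eqmodX W q q' -> eqmodX W (p + q) (p' + q').
Proof. by move=> H1 H2 i Hi; rewrite !coefD H1 ?H2. Qed.

Lemma eqmodXM W p q p' q' : eqmodX W p p' -> eqmodX W q q' -> eqmodX W (p * q) (p' * q').
Proof.
move=> H1 H2 i Hi; rewrite !coefM; apply: eq_bigr => j _.
by rewrite H1 ?H2 //; have := ltn_ord j; lia.
Qed.

Lemma eqmodX_prod W n (F G : nat -> {poly R}) :
  (forall j, (j < n)%N -> eqmodX W (F j) (G j)) ->
  eqmodX W (\prod_(j < n) F j) (\prod_(j < n) G j).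
Proof.
elim: n => [|n IH] H; first by rewrite !big_ord0.
by rewrite !big_ord_recr; apply: eqmodXM; [apply: IH => j ltj; apply: H; rewrite ltnW|apply: H].
Qed.

End Truncation.

(** * Generating series of the complete homogeneous functions *)

Section CompleteHomogeneous.
Variables (F : numFieldType) (A : comAlgType F).
Implicit Types (tt : nat -> A) (u : A).

(* Truncation of exp(u z^j), so that [hgf] truncates exp(sum_j t_j z^j). *)
Definition texp M j u : {poly A} :=
  \sum_(m < M.+1) ((m`!%:R^-1 : F) *: u ^+ m) *: 'X^(j * m).

Definition hgf J M tt : {poly A} := \prod_(j < J) texp M j.+1 (tt j.+1).

(* Any truncation order >= q gives the same coefficient, see [hgf_stable]. *)
Definition hcoef tt q : A := (hgf q q tt)`_q.

Lemma texp_stable q M j u : (0 < j)%N -> (q <= M)%N -> eqmodX q.+1 (texp M j u) (texp q j u).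
Proof.
move=> j0 qM i iq; rewrite !coef_sum [RHS](big_ord_widen M.+1
  (fun m => ((((m`!%:R)^-1 : F) *: u ^+ m) *: 'X^(j * m))`_i)) // [RHS]big_mkcond.
apply: eq_bigr => m _; case: ifP => // /negbT; rewrite -leqNgt => qm.
rewrite coefZ coefXn; suff /negbTE -> : i != (j * m)%N by rewrite mulr0.
by rewrite neq_ltn (leq_trans iq) // (leq_trans qm) // leq_pmull.
Qed.

Lemma texp_large q M j u : (q < j)%N -> eqmodX q.+1 (texp M j u) 1.
Proof.
move=> qj i iq; rewrite coef_sum big_ord_recl big1 ?addr0.
  by rewrite /= fact0 invr1 expr0 scale1r scale1r muln0 expr0.
move=> m _; rewrite coefZ coefXn; suff /negbTE -> : i != (j * (lift ord0 m))%N by rewrite mulr0.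
by rewrite neq_ltn (leq_trans iq) // (leq_trans qj) // leq_pmulr.
Qed.

Lemma hgf_stable q J M tt : (q <= J)%N -> (q <= M)%N -> (hgf J M tt)`_q = hcoef tt q.
Proof.
move=> qJ qM; rewrite /hcoef.
suff H : eqmodX q.+1 (hgf J M tt) (hgf q q tt) by apply: H.
rewrite /hgf [X in eqmodX _ _ X](big_ord_widen J (fun j => texp q j.+1 (tt j.+1))) // [X in eqmodX _ _ X]big_mkcond.
apply: (@eqmodX_prod _ _ _ (fun j => texp M j.+1 (tt j.+1))
   (fun j => if (j < q)%N then texp q j.+1 (tt j.+1) else 1)) => j _.
case: ltnP => jq; first exact: texp_stable.
exact: texp_large.
Qed.

(** With E = exp(u z^j), this is z E' = j u z^j E. Truncation leaves one unmatched term on the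
    right, of degree [j + j * K], which exceeds [K]. *)
Lemma deriv_texp K j u : (0 < j)%N ->
  eqmodX K.+1 ('X * (texp K j u)^`()) ((j%:R * u) *: 'X^j * texp K j u).
Proof.
move=> j0 i iK.
rewrite /texp mulr_sumr [in RHS]big_ord_recr /= coefD [X in _ = _ + X](_ : _ = 0) ?addr0; last first.
  rewrite -scalerAl -scalerAr -exprD !coefZ coefXn.
  suff /negbTE -> : i != (j + j * K)%N by rewrite !mulr0.
  by rewrite neq_ltn (leq_trans iK) // -mulnS leq_pmull.
rewrite raddf_sum mulr_sumr big_ord_recl /= [X in X + _](_ : _ = 0) ?add0r; last first.
  by rewrite muln0 expr0 derivZ -['X^0]/(1) derivC scaler0 mulr0.
rewrite !coef_sum; apply: eq_bigr => m _.
rewrite /bump /= add1n derivZ derivXn -scalerAr -scalerAl -scalerAr -exprD -mulnS.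
rewrite mulrnAr -exprS prednK ?muln_gt0 ?j0 // coefZ coefMn !coefZ coefXn.
case: eqP => _; last first.
  have -> : (false%:R : A) = 0 by [].
  by rewrite mul0rn !mulr0.
have -> : (true%:R : A) = 1 by [].
rewrite !mulr1 mulr_natr.
have -> : ((m.+1)`!%:R^-1 : F) *: u ^+ m.+1 *+ (j * m.+1)
  = ((m.+1)`!%:R^-1 * m.+1%:R : F) *: u ^+ m.+1 *+ j.
  by rewrite -scalerA scaler_nat mulnC mulrnA -scalerMnr.
rewrite factS natrM invfM mulrAC mulVf ?pnatr_eq0 // mul1r.
by rewrite -scalerAr -mulrA -exprS mulr_natl scalerMnr.
Qed.

Lemma deriv_hgf K J tt :
  eqmodX K.+1 ('X * (hgf J K tt)^`())
    ((\sum_(j < J) (j.+1%:R * tt j.+1) *: 'X^(j.+1)) * hgf J K tt).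
Proof.
elim: J => [|J IH]; first by rewrite /hgf !big_ord0 derivC mulr0 mul0r.
rewrite /hgf !big_ord_recr /= -/(hgf J K tt) derivM.
set E := texp _ _ _.
have -> : 'X * ((hgf J K tt)^`() * E + hgf J K tt * E^`()) =
  ('X * (hgf J K tt)^`()) * E + hgf J K tt * ('X * E^`()) by ring.
apply: eqmodX_trans.
  apply: eqmodXD; first by apply: eqmodXM; [exact: IH|exact: eqmodX_refl].
  by apply: eqmodXM; [exact: eqmodX_refl|exact: deriv_texp].
rewrite -/E; set a := (_ *: _); set S := \sum_(j < J) _.
have -> : S * hgf J K tt * E + hgf J K tt * (a * E) = (S + a) * (hgf J K tt * E) by ring.
exact: eqmodX_refl.
Qed.

(* Coefficient form of z H'(z) = (sum_j j t_j z^j) H(z). *)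
Lemma hcoef_newton tt q :
  q%:R * hcoef tt q = \sum_(j < q) (j.+1%:R * tt j.+1) * hcoef tt (q - j.+1).
Proof.
have := @deriv_hgf q q tt q (ltnSn q).
rewrite coefXM; case: q => [|q] /=; first by move=> _; rewrite mul0r big_ord0.
rewrite coef_deriv hgf_stable // mulr_natl => ->.
rewrite mulr_suml coef_sum; apply: eq_bigr => j _.
rewrite -scalerAl coefZ coefXnM ltnS ltnNge -ltnS ltn_ord /=.
by rewrite hgf_stable //; lia.
Qed.

Lemma hcoef0 tt : hcoef tt 0 = 1.
Proof. by rewrite /hcoef /hgf big_ord0 coef1. Qed.

Lemma natP_inj q (a b : A) : q.+1%:R * a = q.+1%:R * b -> a = b.
Proof.
rewrite !mulr_natl -!scaler_nat => E.
have q0 : (q.+1%:R : F) != 0 by rewrite pnatr_eq0.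
by rewrite -[a]scale1r -[b]scale1r -(mulVf q0) -!scalerA E.
Qed.

(** Since exp(sum_j y^j z^j / j) = 1 / (1 - y z), the series of [tt] is 1 - y z times that of [ss].
    The coefficients are compared by induction through Newton's recursion. *)
Lemma hcoef_shift tt ss (y : A) :
  (forall j, ss j.+1 = tt j.+1 + (j.+1%:R^-1 : F) *: y ^+ j.+1) ->
  forall q, hcoef tt q = hcoef ss q - y * (if q is q'.+1 then hcoef ss q' else 0).
Proof.
move=> Hss q; elim/ltn_ind: q => -[|q] IH; first by rewrite !hcoef0 mulr0 subr0.
apply: (@natP_inj q); rewrite hcoef_newton mulrBr hcoef_newton.
(* [S] and [G] are the parts of the recursion for [ss] that come from [tt] and from [y]. *)
pose S m := \sum_(j < m) (j.+1%:R * tt j.+1) * hcoef ss (m - j.+1).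
pose G m := \sum_(j < m) y ^+ j.+1 * hcoef ss (m - j.+1).
have N m : \sum_(j < m) (j.+1%:R * ss j.+1) * hcoef ss (m - j.+1) = S m + G m.
  rewrite -big_split; apply: eq_bigr => j _ /=; rewrite Hss -mulrDl; congr (_ * _).
  rewrite mulrDr; congr (_ + _).
  by rewrite mulr_natl -scaler_nat scalerA mulfV ?scale1r // pnatr_eq0.
have Gr : G q.+1 = y * hcoef ss q + y * G q.
  rewrite /G big_ord_recl subn1 expr1; congr (_ + _); rewrite mulr_sumr.
  by apply: eq_bigr => j _; rewrite /bump /= ?add1n subSS mulrA -exprS.
rewrite N Gr.
have -> : q.+1%:R * (y * hcoef ss q) = y * hcoef ss q + y * (S q + G q).
  by rewrite -N -hcoef_newton -natr1; ring.
have -> : \sum_(j < q.+1) (j.+1%:R * tt j.+1) * hcoef tt (q.+1 - j.+1) = S q.+1 - y * S q.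
  rewrite /S !big_ord_recr /= subnn !hcoef0 addrAC; congr (_ + _).
  rewrite mulr_sumr -sumrB; apply: eq_bigr => j _.
  rewrite IH; last by lia.
  have -> : (q.+1 - j.+1 = (q - j.+1).+1)%N by have := ltn_ord j; lia.
  ring.
ring.
Qed.

Lemma eq_hcoef tt ss : (forall j, tt j.+1 = ss j.+1) -> hcoef tt =1 hcoef ss.
Proof.
move=> E q; rewrite /hcoef /hgf (eq_bigr (fun j : 'I_q => texp q j.+1 (ss j.+1))) // => j _.
by rewrite E.
Qed.

End CompleteHomogeneous.

(** Distributing the product of truncated exponentials gives a sum over exponent functions [f]; the
    coefficient of degree [q] selects those of weight [q]. *)
Lemma hcompE (tt : nat -> P) q : hcomp tt q = hcoef tt q.
Proof.
rewrite /hcoef /hgf /texp bigA_distr_bigA coef_sum /hcomp big_mkcond.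
apply: eq_bigr => f _.
transitivity (((\prod_(j < q) ((((f j)`!%:R)^-1 : CC) *: tt j.+1 ^+ f j)) *:
    'X^(\sum_(j < q) j.+1 * f j) : {poly P})`_q); last first.
  by congr (_`_q); rewrite expr_sum -scaler_prod.
rewrite coefZ coefXn eq_sym.
by case: ifP => _; rewrite ?mulr1 ?mulr0.
Qed.

Lemma eq_hcomp (tt ss : nat -> P) : (forall j, tt j.+1 = ss j.+1) -> hcomp tt =1 hcomp ss.
Proof.
by move=> E q; apply: eq_bigr => f _; apply: eq_bigr => j _; rewrite E.
Qed.

(** * Frames of polynomials and the factorization of their minors *)

Section Frame.
Variables (R : comNzRingType) (W D : nat).
Implicit Types (ys : seq R) (y : R) (h : nat -> R).

Definition ser h : {poly R} := \poly_(q < W) h q.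
Definition geom y : {poly R} := ser (fun p => y ^+ p).
Definition evenpoly ys : {poly R} := \prod_(y <- ys) (1 - y *: 'X).
Definition frame ys : seq {poly R} :=
  [seq 'X^j | j <- iota 0 D] ++ [seq 'X^D * geom y | y <- ys].

Lemma size_frame ys : size (frame ys) = (D + size ys)%N.
Proof. by rewrite size_cat !size_map size_iota. Qed.

Lemma nth_frameL ys j : (j < D)%N -> nth 0 (frame ys) j = 'X^j.
Proof.
by move=> jD; rewrite nth_cat size_map size_iota jD (nth_map 0%N) ?size_iota // nth_iota.
Qed.

Lemma nth_frameR ys a : (a < size ys)%N ->
  nth 0 (frame ys) (D + a) = 'X^D * geom (nth 0 ys a).
Proof.
move=> ak; rewrite nth_cat size_map size_iota ltnNge leq_addr /= addKn.
by rewrite (nth_map 0).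
Qed.

Lemma size_linear1 y : (size (1 - y *: 'X)%R <= 2)%N.
Proof.
apply: leq_trans (size_polyD _ _) _; rewrite size_poly1 size_polyN geq_max /=.
by apply: leq_trans (size_scale_leq _ _) _; rewrite size_polyX.
Qed.

Lemma size_evenpoly ys : (size (evenpoly ys) <= (size ys).+1)%N.
Proof.
rewrite /evenpoly; elim: ys => [|y ys IH]; first by rewrite big_nil size_poly1.
rewrite big_cons; apply: leq_trans (size_polyMleq _ _) _.
by rewrite -subn1 leq_subLR; exact: leq_add (size_linear1 y) IH.
Qed.

Lemma geom_inv y : eqmodX W ((1 - y *: 'X) * geom y) 1.
Proof.
move=> i iW; rewrite mulrBl mul1r coefB -scalerAl coefZ coefXM coef1 !coef_poly iW.
case: i iW => [|i] iW /=; first by rewrite mulr0 subr0 expr0.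
by rewrite (ltnW iW) exprS subrr.
Qed.

Lemma evenpoly_coef0 ys : (evenpoly ys)`_0 = 1.
Proof.
rewrite /evenpoly; elim: ys => [|y ys IH]; first by rewrite big_nil coef1.
by rewrite big_cons coef0M IH mulr1 coefB coef1 coefZ coefX mulr0 subr0.
Qed.

(** The factor [geom y] cancels the factor [1 - y *: 'X] of [evenpoly ys] up to order [W], which
    leaves a polynomial of degree less than [D + size ys]; for ['X^j] with [j < D] the degree bound
    is immediate. *)
Lemma frame_evenpoly ys j i : (j < D + size ys)%N -> (D + size ys <= i < W)%N ->
  (nth 0 (frame ys) j * evenpoly ys)`_i = 0.
Proof.
move=> jn /andP[ni iW]; case: (ltnP j D) => jD.
  rewrite nth_frameL // coefXnM; case: ltnP => // ji.
  rewrite nth_default //; apply: leq_trans (size_evenpoly _) _; lia.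
rewrite -(subnKC jD); set a := (j - D)%N; have ak : (a < size ys)%N by rewrite /a; lia.
rewrite nth_frameR //; set y := nth 0 ys a; have yin : y \in ys by exact: mem_nth.
have -> : evenpoly ys = (1 - y *: 'X) * evenpoly (rem y ys).
  by rewrite /evenpoly (big_rem y).
rewrite -mulrA coefXnM; case: ltnP => // Di.
rewrite mulrA [geom y * _]mulrC.
rewrite (eqmodXM (@geom_inv y) (@eqmodX_refl _ W (evenpoly (rem y ys)))); last by lia.
rewrite mul1r nth_default //; apply: leq_trans (size_evenpoly _) _.
by rewrite size_rem // prednK ?(leq_ltn_trans _ ak) // leq_subRL.
Qed.

Lemma coef_bound_mul (n : nat) (p q : {poly R}) i : (i < W)%N ->
  (forall l, (n <= l < W)%N -> p`_l = 0) ->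
  (p * q)`_i = \sum_(l < n) ('X^l * q)`_i * p`_l.
Proof.
move=> iW p0.
rewrite (@eqmodXM _ W p q (\sum_(l < n) p`_l *: 'X^l) q) //; last first.
  move=> l lW; rewrite -(poly_def n (fun l => p`_l)) coef_poly; case: ltnP => // nl.
  by rewrite p0 // nl.
rewrite mulr_suml coef_sum; apply: eq_bigr => l _.
by rewrite -scalerAl coefZ mulrC.
Qed.

(* Multiplying the frame by [evenpoly ys] turns [ht] into [hs]; the transition
   matrix is a unitriangular Toeplitz matrix times diag(1, Vandermonde). *)
Lemma det_frame ys (hs ht : nat -> R) (S : seq nat) (k := size ys) :
  eqmodX W (ser ht) (evenpoly ys * ser hs) ->
  (D + k <= W)%N -> all (fun B => B < W)%N S -> size S = (D + k)%N ->
  \det (\matrix_(i < D + k, j < D + k) (nth 0 (frame ys) j * ser ht)`_(nth 0%N S i)) =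
  \det (\matrix_(i < D + k, j < D + k) ('X^j * ser hs)`_(nth 0%N S i)) *
  \det (Vandermonde k (\row_(a < k) nth 0 ys a)).
Proof.
move=> Eh nW aS sS; pose Q (j : nat) := nth 0 (frame ys) j.
pose E := evenpoly ys.
have SW (i : 'I_(D + k)) : (nth 0%N S i < W)%N by apply: (allP aS); rewrite mem_nth ?sS.
pose H := \matrix_(i < D + k, j < D + k) ('X^j * ser hs)`_(nth 0%N S i).
pose C := \matrix_(i < D + k, j < D + k) (Q j * E)`_i.
pose T := \matrix_(i < D + k, l < D + k) (if (l <= i)%N then E`_(i - l) else 0).
pose G := \matrix_(l < D + k, j < D + k) (Q j)`_l.
have -> : \matrix_(i, j) (Q j * ser ht)`_(nth 0%N S i) = H *m C.
  apply/matrixP => i j; rewrite !mxE.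
  (* Below order [W] the product [Q j * E] has degree less than [D + k], so only the first [D + k]
     shifts of [ser hs] enter. *)
  rewrite (eqmodXM (@eqmodX_refl _ W (Q j)) Eh) // mulrA (@coef_bound_mul (D + k)) //.
    by apply: eq_bigr => l _; rewrite !mxE.
  by move=> l ?; rewrite frame_evenpoly.
have -> : C = T *m G.
  apply/matrixP => i j; rewrite !mxE coefM (big_ord_widen (D + k)
    (fun l => (Q j)`_l * E`_(i - l))) ?ltn_ord // big_mkcond; apply: eq_bigr => l _.
  by rewrite !mxE ltnS; case: leqP; rewrite ?mul0r // mulrC.
rewrite !det_mulmx; congr (_ * _).
rewrite det_trig; last first.
  by apply/is_trig_mxP => i j ij; rewrite mxE leqNgt ij.
rewrite big1 ?mul1r; last by move=> i _; rewrite mxE leqnn subnn evenpoly_coef0.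
have -> : G = block_mx 1%:M 0 0 (Vandermonde k (\row_(a < k) nth 0 ys a)).
  apply/matrixP => i j; rewrite !mxE.
  case: splitP => i' Ei; rewrite !mxE; case: splitP => j' Ej; rewrite !mxE /Q Ei Ej.
  - rewrite nth_frameL // coefXn (inj_eq val_inj) //.
  - by rewrite nth_frameR // coefXnM ltn_ord.
  - rewrite nth_frameL // coefXn; case: eqP => // E'.
    by have := ltn_ord j'; rewrite -E' ltnNge leq_addr.
  - rewrite nth_frameR // coefXnM ltnNge leq_addr /= addKn coef_poly.
    by rewrite (leq_trans _ nW) // (leq_trans (ltn_ord i')) // leq_addl.
by rewrite det_ublock det1 mul1r.
Qed.

End Frame.

(** * Partitions and their beta-sets *)

Section Partitions.

(** The zeros of a nonincreasing list stand at its end, where the default value of [nth] replaces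
    them. *)
Lemma nth_filter_pos (m : seq nat) i : sorted geq m ->
  nth 0%N [seq p <- m | (0 < p)%N] i = nth 0%N m i.
Proof.
move=> sm; have tr : transitive geq by move=> a b c ab bc; exact: leq_trans bc ab.
elim: m i sm => [|[|a] m IH] i //= sm; last by case: i => // i; exact: IH (path_sorted sm).
have z : all (pred1 0%N) m.
  by move: sm; rewrite path_sortedE // => /andP[+ _]; apply: sub_all => b /=; rewrite leqn0.
have -> : [seq p <- m | (0 < p)%N] = [::].
  by apply/eqP; rewrite -[_ == _]negbK -has_filter -all_predC; apply: sub_all z => b /eqP ->.
rewrite nth_nil; case: i => // i /=.
case: (ltnP i (size m)) => im; last by rewrite nth_default.
by rewrite (eqP (allP z _ (mem_nth 0%N im))).
Qed.

Lemma filter_pos_inj (m m' : seq nat) : sorted geq m -> sorted geq m' -> size m = size m' ->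
  [seq p <- m | (0 < p)%N] = [seq p <- m' | (0 < p)%N] -> m = m'.
Proof.
move=> sm sm' zz E; apply: (@eq_from_nth _ 0%N) => // i _.
by rewrite -(nth_filter_pos i sm) E nth_filter_pos.
Qed.

Lemma filter_pos_partition (m : seq nat) : sorted geq m ->
  is_partition [seq p <- m | (0 < p)%N].
Proof.
move=> sm; rewrite /is_partition filter_all andbT.
by apply: sorted_filter sm => a b c ab bc; exact: leq_trans bc ab.
Qed.

Lemma sumn_filter_pos (m : seq nat) : sumn [seq p <- m | (0 < p)%N] = sumn m.
Proof. by elim: m => // -[|a] m IH /=; rewrite IH. Qed.

Lemma partition_size (l : seq nat) : is_partition l -> (size l <= sumn l)%N.
Proof.
case/andP => _; elim: l => //= a l IH /andP[a0 /IH al].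
by rewrite -add1n leq_add.
Qed.

Lemma partition_part_le (l : seq nat) i : (nth 0%N l i <= sumn l)%N.
Proof.
elim: l i => [|a l IH] [|i] //=; first exact: leq_addr.
exact: leq_trans (IH i) (leq_addl _ _).
Qed.

Definition padded n (l : seq nat) := [seq nth 0%N l i | i <- iota 0 n].

Lemma padded_geq n l : sorted geq l -> sorted geq (padded n l).
Proof.
have tr : transitive geq by move=> a b c ab bc; exact: leq_trans bc ab.
move=> sl; rewrite /padded sorted_map.
apply: (@sub_sorted _ ltn) (iota_ltn_sorted 0 n) => i j /= ij.
case: (ltnP j (size l)) => jl; last by rewrite /relpre /= (nth_default _ jl).
by apply: (sorted_ltn_nth tr) => //; rewrite inE (ltn_trans ij).
Qed.

Lemma padded_filter n l : is_partition l -> (size l <= n)%N ->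
  [seq p <- padded n l | (0 < p)%N] = l.
Proof.
move=> /andP[_ pl] sl; rewrite /padded -(subnKC sl) iotaD map_cat filter_cat add0n.
have -> : [seq nth 0%N l i | i <- iota 0 (size l)] = l by rewrite -/(mkseq _ _) mkseq_nth.
rewrite (all_filterP pl) -[RHS]cats0; congr (_ ++ _); apply/eqP.
rewrite -[_ == _]negbK -has_filter -all_predC all_map; apply/allP => i.
by rewrite mem_iota => /andP[li _] /=; rewrite nth_default.
Qed.

Lemma strip_partition d (f : {ffun 'I_d -> 'I_d.+1}) : is_pad f ->
  is_partition (strip f) && (sumn (strip f) == d).
Proof.
by case/andP=> sf /eqP zf; rewrite filter_pos_partition //= sumn_filter_pos zf.
Qed.

Lemma strip_inj d (f g : {ffun 'I_d -> 'I_d.+1}) : is_pad f -> is_pad g ->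
  strip f = strip g -> f = g.
Proof.
case/andP=> sf _ /andP[sg _] /filter_pos_inj E; apply/ffunP => i; apply: val_inj => /=.
have : padseq f = padseq g by apply: E => //; rewrite !size_map.
have nthp (h : {ffun 'I_d -> 'I_d.+1}) : nth 0%N (padseq h) i = h i.
  by rewrite (nth_map i) ?size_enum_ord // nth_ord_enum.
by rewrite -!nthp => ->.
Qed.

Lemma partition_strip d l : is_partition l -> sumn l = d ->
  exists2 f : {ffun 'I_d -> 'I_d.+1}, is_pad f & l = strip f.
Proof.
move=> pl sl; pose f : {ffun 'I_d -> 'I_d.+1} := [ffun i => inord (nth 0%N l (val i))].
have Ef : padseq f = padded d l.
  rewrite /padseq /padded -val_enum_ord -map_comp; apply: eq_map => i /=.
  by rewrite ffunE inordK // ltnS (leq_trans (partition_part_le _ _)) ?sl.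
have fl : [seq p <- padded d l | (0 < p)%N] = l by rewrite padded_filter // -sl partition_size.
exists f; last by rewrite /strip Ef fl.
rewrite /is_pad Ef padded_geq; last by case/andP: pl.
by rewrite -sumn_filter_pos fl sl eqxx.
Qed.

(* [blam S] is the partition whose beta-set (first-column hook lengths, with
   trailing zero parts allowed) is the strictly increasing list [S]. *)
Definition blam (S : seq nat) : seq nat :=
  [seq p <- rev [seq (nth 0%N S i - i)%N | i <- iota 0 (size S)] | (0 < p)%N].

Lemma beta_ge S i : sorted ltn S -> (i < size S)%N -> (i <= nth 0%N S i)%N.
Proof.
move=> sS; elim: i => // i IH iS; apply: leq_ltn_trans (IH (ltnW iS)) _.
by apply: (sorted_ltn_nth ltn_trans) => //; rewrite inE ?(ltnW iS).
Qed.

Lemma rev_iota_map (T : Type) (f : nat -> T) n :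
  rev [seq f i | i <- iota 0 n] = [seq f (n - i.+1)%N | i <- iota 0 n].
Proof.
case: n => // n; have x0 := f 0%N.
apply: (@eq_from_nth _ x0); rewrite size_rev !size_map // => i.
rewrite size_iota => ltin; rewrite nth_rev ?size_map ?size_iota //.
by rewrite !(nth_map 0%N) ?size_iota ?nth_iota ?add0n //; lia.
Qed.

Lemma beta_parts_geq S : sorted ltn S ->
  sorted geq (rev [seq (nth 0%N S i - i)%N | i <- iota 0 (size S)]).
Proof.
move=> sS; rewrite rev_sorted; apply/(sortedP 0%N) => i.
rewrite size_map size_iota => iS; rewrite !(nth_map 0%N) ?size_iota ?(ltnW iS) //.
rewrite !nth_iota ?add0n ?(ltnW iS) //.
have : (nth 0%N S i < nth 0%N S i.+1)%N.
  by apply: (sorted_ltn_nth ltn_trans) => //; rewrite inE ?(ltnW iS).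
by rewrite /=; have := beta_ge sS iS; lia.
Qed.

Lemma lamL_wshift S : sorted ltn S -> lamL (wshift (size S) S) = blam S.
Proof.
move=> sS; rewrite /lamL /blam size_map (@sorted_sort _ <=%R) //; last first.
- by apply: sub_sorted (wshift_sorted (size S) sS) => a b /ltW.
- exact: le_trans.
rewrite rev_iota_map; congr filter; apply/eq_in_map => i; rewrite mem_iota add0n /= => iS.
rewrite (nth_map 0%N); last by lia.
have : (size S - i.+1 <= nth 0%N S (size S - i.+1))%N by apply: beta_ge => //; lia.
set B := nth _ _ _; lia.
Qed.

Lemma sumn_blam S : sorted ltn S ->
  (sumn (blam S) + \sum_(i < size S) i = \sum_(i < size S) nth 0%N S i)%N.
Proof.
move=> sS; rewrite sumn_filter_pos sumn_rev sumnE big_map.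
rewrite -[X in iota 0 X]subn0 -/(index_iota 0 _) big_mkord -big_split.
by apply: eq_bigr => i _; rewrite /= subnK // beta_ge.
Qed.

Lemma blam_partition S : sorted ltn S -> is_partition (blam S).
Proof. by move=> sS; rewrite filter_pos_partition // beta_parts_geq. Qed.

Lemma blam_inj S S' : sorted ltn S -> sorted ltn S' -> size S = size S' ->
  blam S = blam S' -> S = S'.
Proof.
move=> sS sS' zz /filter_pos_inj; rewrite !beta_parts_geq // !size_rev !size_map !size_iota.
move=> /(_ isT isT zz) /(can_inj revK) E; apply: (@eq_from_nth _ 0%N) => // i iS.
have := congr1 (fun s => nth 0%N s i) E; rewrite /= -zz !(nth_map 0%N) ?size_iota //.
rewrite nth_iota // add0n.
have := beta_ge sS iS; have := beta_ge (i := i) sS'; rewrite -zz => /(_ iS); lia.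
Qed.

(** Pad [l] with zero parts to length [n], read it in increasing order and add the staircase
    [0, 1, ..., n - 1]. *)
Lemma partition_blam n l : is_partition l -> (size l <= n)%N ->
  exists S, [/\ sorted ltn S, size S = n, all (fun B => B < n + sumn l)%N S & blam S = l].
Proof.
move=> pl zl; pose S := [seq (i + nth 0%N l (n - i.+1))%N | i <- iota 0 n].
have zS : size S = n by rewrite size_map size_iota.
have nS i : (i < n)%N -> nth 0%N S i = (i + nth 0%N l (n - i.+1))%N.
  by move=> iN; rewrite (nth_map 0%N) ?size_iota // nth_iota.
have pg := padded_geq n (proj1 (andP pl)).
exists S; split => //.
- apply/(sortedP 0%N) => i; rewrite zS => iN.
  rewrite !nS ?(ltnW iN) //= addSn ltnS leq_add2l.
  have tr : transitive geq by move=> a b c ab bc; exact: leq_trans bc ab.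
  have := @sorted_ltn_nth _ geq tr 0%N (padded n l) pg (n - i.+2)%N (n - i.+1)%N.
  rewrite !inE size_map size_iota => H.
  have := H ltac:(lia) ltac:(lia) ltac:(lia).
  by rewrite /= !(nth_map 0%N) ?size_iota ?nth_iota ?add0n //; lia.
- rewrite /S all_map; apply/allP => i; rewrite mem_iota add0n => /= iN.
  by have := partition_part_le l (n - i.+1)%N; lia.
- rewrite /blam zS rev_iota_map -[RHS](padded_filter pl zl); congr filter.
  apply/eq_in_map => i; rewrite mem_iota add0n => /= iN.
  rewrite nS; last by lia.
  by rewrite addKn; congr nth; lia.
Qed.

(** Both lists enumerate the partitions of [d] once each: such a partition has at most [d <= n]
    parts, and the letters of its beta-set of size [n] stay below [n + d <= W]. *)
Lemma perm_strip_blam d n W : (d <= n)%N -> (n + d <= W)%N ->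
  perm_eq [seq strip f | f <- [seq f <- enum {ffun 'I_d -> 'I_d.+1} | is_pad f]]
    [seq blam w | w <- [seq w <- words W n | sorted ltn w && (sumn (blam w) == d)]].
Proof.
move=> dn nW; apply: uniq_perm.
- rewrite map_inj_in_uniq; first by apply/filter_uniq/enum_uniq.
  move=> f g.
  by rewrite !mem_filter => /andP[pf _] /andP[pg _]; exact: strip_inj.
- rewrite map_inj_in_uniq ?filter_uniq ?words_uniq // => w w'.
  rewrite !mem_filter !mem_words => /andP[/andP[sw _] /andP[/eqP zw _]].
  move=> /andP[/andP[sw' _] /andP[/eqP zw' _]].
  by apply: blam_inj => //; rewrite zw.
move=> l; apply/mapP/mapP => [[f] | [w]].
  rewrite mem_filter => /andP[/strip_partition/andP[pl /eqP zl] _] ->.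
  have [|w [sw zw aw El]] := @partition_blam n _ pl.
    by apply: leq_trans (partition_size pl) _; rewrite zl.
  exists w => //; rewrite mem_filter mem_words sw El zl zw !eqxx /=.
  by apply: sub_all aw => B /= HB; apply: leq_trans HB _; rewrite zl.
rewrite mem_filter => /andP[/andP[sw /eqP zw] _] ->.
have [f pf ->] := partition_strip (blam_partition sw) zw.
by exists f => //; rewrite mem_filter pf mem_enum.
Qed.

End Partitions.

(** * Jacobi-Trudi determinants indexed by beta-sets *)

Section BetaDeterminant.
Variable A : comNzRingType.
Implicit Types (h : nat -> A) (S : seq nat).

Definition hsub h (B j : nat) : A := if (j <= B)%N then h (B - j)%N else 0.
(** For increasing [S], the Jacobi-Trudi determinant of [blam S] with rows and columns in reversed
    order, and with one row for each trailing zero part. *)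
Definition bdet h S : A := \det (\matrix_(i < size S, j < size S) hsub h (nth 0%N S i) j).

Lemma bdetE h S n : size S = n -> bdet h S = \det (\matrix_(i < n, j < n) hsub h (nth 0%N S i) j).
Proof. by move=> <-. Qed.

(** The beta-number 0 gives the first row (1, 0, ..., 0); expanding along it drops one zero part and
    lowers the other beta-numbers by one. *)
Lemma bdet_cons0 h S : h 0%N = 1 -> all (fun B => 0 < B)%N S ->
  bdet h (0%N :: S) = bdet h (map predn S).
Proof.
move=> h0 S0; rewrite (@bdetE _ _ (1 + size S)) // (@bdetE _ (map _ _) (size S)) ?size_map //.
set M := \matrix_(i < 1 + _, j < _) _.
rewrite -(submxK M) (_ : ursubmx M = 0); last first.
  by apply/matrixP => i j; rewrite !mxE /= ord1 /hsub.
rewrite det_lblock det_mx11 !mxE /= /hsub /= subnn h0 mul1r.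
congr (\det _); apply/matrixP => i j; rewrite !mxE /= (nth_map 0%N) ?ltn_ord //.
have : (0 < nth 0%N S i)%N by apply: (allP S0); rewrite mem_nth.
by rewrite /hsub; case: (nth 0%N S i) => // B _ /=; rewrite !add1n ltnS subSS.
Qed.

Lemma det_rev n (M : 'M[A]_n) : \det (\matrix_(i, j) M (rev_ord i) (rev_ord j)) = \det M.
Proof.
pose s := perm (@rev_ord_inj n).
have -> : \matrix_(i, j) M (rev_ord i) (rev_ord j) = row_perm s (col_perm s M).
  by apply/matrixP => i j; rewrite !mxE !permE.
rewrite row_permE col_permE !det_mulmx !det_perm odd_permV mulrC -mulrA.
by rewrite -signr_addb addbb mulr1.
Qed.

(** In each nonzero Leibniz term the indices of the [h] add up to the sum of [S] minus 0 + 1 + ...;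
    the powers of [x] are placed on both sides to avoid a division. *)
Lemma bdet_scale h x S :
  bdet (fun q => h q * x ^+ q) S * x ^+ (\sum_(i < size S) i) =
  bdet h S * x ^+ (\sum_(i < size S) nth 0%N S i).
Proof.
rewrite /bdet /determinant !mulr_suml; apply: eq_bigr => s _; rewrite -!mulrA; congr (_ * _).
rewrite -!prodrXr [X in _ * X = _](reindex_inj (@perm_inj _ s)) -!big_split; apply: eq_bigr => i _ /=.
rewrite !mxE /hsub; case: leqP => H; last by rewrite !mul0r.
by rewrite -mulrA -exprD subnK.
Qed.

End BetaDeterminant.

Lemma schurE l tt n : size l = n -> schur l tt =
  \det (\matrix_(i < n, j < n) hz tt ((nth 0%N l i)%:Z - i%:Z + j%:Z)).
Proof. by move=> <-. Qed.

(** By induction on the size, a leading beta-number 0 is removed. Otherwise all parts are positive,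
    nothing is filtered out, and reversing rows and columns gives the matrix of [schur]. *)
Lemma bdet_schur tt S : sorted ltn S -> bdet (hcomp tt) S = schur (blam S) tt.
Proof.
have [n] := ubnP (size S); elim: n S => // n IH S; rewrite ltnS => zS sS.
have h0 : hcomp tt 0 = 1 by rewrite hcompE hcoef0.
case: S zS sS => [|[|B] S] zS sS; first by rewrite /bdet /schur !det_mx00.
  have S0 : all (fun B => 0 < B)%N S.
    by move: sS; rewrite /= path_sortedE => [/andP[]|]; last exact: ltn_trans.
  have sS' : sorted ltn (map predn S).
    rewrite sorted_map; apply/(sortedP 0%N) => i iS /=.
    have : (nth 0%N S i < nth 0%N S i.+1)%N.
      apply: (sorted_ltn_nth ltn_trans 0%N (path_sorted sS)) => //; rewrite inE //.
      exact: ltnW.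
    have : (0 < nth 0%N S i)%N by apply: (allP S0); rewrite mem_nth // ltnW.
    lia.
  rewrite bdet_cons0 // IH ?size_map //; congr schur.
  rewrite /blam /= rev_cons -cats1 filter_cat /= cats0; congr (filter _ (rev _)).
  rewrite size_map (iotaDl 1 0) -map_comp.
  apply/eq_in_map => i; rewrite mem_iota add0n => /= iS.
  by rewrite (nth_map 0%N) // add1n /= subnS -!subn1 subnAC.
have : (0 < nth 0%N (B.+1 :: S) 0)%N by [].
move: (B.+1 :: S) zS sS => {B S} T zS sS T00.
have T0 i : (i < size T)%N -> (i < nth 0%N T i)%N.
  elim: i => // i IHi iT; apply: leq_ltn_trans (IHi (ltnW iT)) _.
  by apply: (sorted_ltn_nth ltn_trans) => //; rewrite inE ?(ltnW iT).
have Eb : blam T = [seq (nth 0%N T (size T - i.+1) - (size T - i.+1))%N | i <- iota 0 (size T)].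
  rewrite /blam rev_iota_map; apply/all_filterP; rewrite all_map; apply/allP => i.
  by rewrite mem_iota add0n => /= iT; rewrite subn_gt0 T0 // ltn_subrL (leq_ltn_trans _ iT).
rewrite (@schurE _ _ (size T)); last by rewrite Eb size_map size_iota.
rewrite /bdet -det_rev; congr (\det _); apply/matrixP => i j; rewrite !mxE Eb.
rewrite (nth_map 0%N) ?size_iota ?ltn_ord // nth_iota ?ltn_ord // add0n /=.
have := T0 (size T - i.+1)%N; move: (ltn_ord i) (ltn_ord j).
move: (nat_of_ord i) (nat_of_ord j) => {}i {}j.
move: (size T) => m; move: (nth 0%N T _) => C iT jT H; have HC := H ltac:(lia).
rewrite /hsub; case: leqP => HC'.
  have -> : (C - (m - i.+1))%N%:Z - i%:Z + j%:Z = (C - (m - j.+1))%N%:Z by lia.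
  by [].
by case E: (_ + _) => [q|q] //; exfalso; lia.
Qed.

Lemma bdet_polyX (A : comNzRingType) (h : nat -> A) S : sorted ltn S ->
  bdet (fun q => h q *: 'X^q) S = bdet h S *: 'X^(sumn (blam S)).
Proof.
move=> sS; set N := (\sum_(i < size S) i)%N.
have E1 : bdet (fun q => h q *: 'X^q) S = bdet (fun q => (h q)%:P * 'X^q) S.
  congr (\det _); apply/matrixP => i j; rewrite !mxE /hsub.
  by case: ifP; rewrite // mul_polyC.
have E2 : bdet (fun q => (h q)%:P) S = (bdet h S)%:P.
  rewrite /bdet -det_map_mx; congr (\det _); apply/matrixP => i j; rewrite !mxE /hsub.
  by case: ifP.
apply: (monic_rreg (monicXn A N)) => /=.
by rewrite E1 bdet_scale E2 -sumn_blam // exprD mulrA mul_polyC.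
Qed.

Lemma det_Xser (R : comNzRingType) W (h : nat -> R) S n : size S = n ->
  all (fun B => B < W)%N S ->
  \det (\matrix_(i < n, j < n) ('X^j * ser W h)`_(nth 0%N S i)) = bdet h S.
Proof.
move=> zS aS; rewrite (bdetE _ zS); congr (\det _); apply/matrixP => i j; rewrite !mxE.
rewrite coefXnM /hsub ltnNge; case: leqP => //= jS; rewrite coef_poly.
have : (nth 0%N S i < W)%N by apply: (allP aS); rewrite mem_nth ?zS.
by move=> H; rewrite (leq_ltn_trans (leq_subr _ _) H).
Qed.

(** Iterates [hcoef_shift], with one factor of [evenpoly] for each element of [ys]; giving [h_q] the
    weight ['X^q] turns [y] into [y *: 'X]. *)
Lemma ser_shifts (F : numFieldType) (A : comAlgType F) W (ys : seq A) (tt ss : nat -> A) :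
  (forall j, ss j.+1 = tt j.+1 + \sum_(y <- ys) (j.+1%:R^-1 : F) *: y ^+ j.+1) ->
  eqmodX W (ser W (fun q => hcoef tt q *: 'X^q))
    (evenpoly [seq y *: 'X | y <- ys] * ser W (fun q => hcoef ss q *: 'X^q)).
Proof.
elim: ys tt => [|y ys IH] tt Hs.
  rewrite /evenpoly big_nil mul1r => i iW; rewrite !coef_poly iW; congr (_ *: _).
  by apply: eq_hcoef => j; rewrite Hs big_nil addr0.
pose rr j := tt j + (j%:R^-1 : F) *: y ^+ j.
rewrite /evenpoly /= big_cons -/(evenpoly _) -mulrA.
apply: (@eqmodX_trans _ _ _ ((1 - (y *: 'X) *: 'X) * ser W (fun q => hcoef rr q *: 'X^q))).
  move=> i iW; rewrite mulrBl mul1r coefB -scalerAl coefZ coefXM !coef_poly iW.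
  rewrite (@hcoef_shift _ _ tt rr y) // scalerBl; congr (_ - _).
  case: i iW => [|i] iW /=; first by rewrite !mulr0 scale0r.
  by rewrite (ltnW iW) -scalerAr -scalerAl -exprS scalerA mulrC.
apply: eqmodXM; first exact: eqmodX_refl.
by apply: IH => j; rewrite Hs big_cons /rr addrA.
Qed.

Lemma coef_algZX (F : numFieldType) (A : comAlgType F) (c : F) (a : A) n d :
  ((c%:A)%:P * (a *: 'X^n))`_d = if n == d then c *: a else 0.
Proof.
rewrite coefCM coefZ coefXn eq_sym mulr_algl.
by case: eqP => _; rewrite ?mulr1 // mulr0 scaler0.
Qed.

(** * The multi-Fay identity *)

Section MultiFay.
Variables (pi : seq nat -> CC) (D k : nat) (tt : nat -> P).
Hypothesis pluckerP : forall k N I J, plucker_ok k N I J -> plucker_C pi I J = 0.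

(** These bounds let increasing words of length [r] in [W] letters reach every partition of size at
    most [D]. *)
Let r := (D + k)%N.
Let W := (D + k + D.+1)%N.

Definition scal : {rmorphism CC -> {poly P}} := polyC \o in_alg P.

Definition yvar (i : int) : {poly P} := xvar i *: 'X.

Definition tshift (L : seq int) (j : nat) : P :=
  tt j + \sum_(i <- L) (j%:R^-1 : CC) *: xvar i ^+ j.

(* Only partitions in a box; the coefficients up to degree [D] are those of tau. *)
Definition tau_poly (ss : nat -> P) : {poly P} :=
  \sum_(S <- words W r | sorted ltn S)
     scal (pi (blam S)) * (schur (blam S) ss *: 'X^(sumn (blam S))).

Definition frame_vectors (L : seq int) : seq (nat -> {poly P}) :=
  [seq (fun B => (q * ser W (fun q => hcoef tt q *: 'X^q))`_B) | q <- frame W D (map yvar L)].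

Definition ydiff (i j : int) : {poly P} := yvar i - yvar j.

(* Up to sign, Delta(y_L) tau(t + [x_L]); it vanishes when [L] has a repetition. *)
Definition fay_factor (L : seq int) : {poly P} :=
  (sgnL L)%:~R * pairprod ydiff L * tau_poly (tshift L).

Lemma coef_tau_poly ss d : (d <= D)%N ->
  (tau_poly ss)`_d = \sum_(f : {ffun 'I_d -> 'I_d.+1} | is_pad f)
             pi (strip f) *: schur (strip f) ss.
Proof.
move=> dD; pose G l := pi l *: schur l ss.
have dr : (d <= r)%N by rewrite /r; lia.
have rW : (r + d <= W)%N by rewrite /r /W; lia.
have -> : \sum_(f : {ffun 'I_d -> 'I_d.+1} | is_pad f) pi (strip f) *: schur (strip f) ss =
   \sum_(l <- [seq strip f | f <- [seq f <- enum {ffun 'I_d -> 'I_d.+1} | is_pad f]]) G l.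
  by rewrite big_map big_filter big_enum_cond.
rewrite (perm_big _ (perm_strip_blam dr rW)) big_map big_filter coef_sum big_mkcondr.
by apply: eq_bigr => S _; rewrite (coef_algZX (pi (blam S)) (schur (blam S) ss)).
Qed.

Lemma tshift_hcoef L : eqmodX W (ser W (fun q => hcoef tt q *: 'X^q))
    (evenpoly (map yvar L) * ser W (fun q => hcoef (tshift L) q *: 'X^q)).
Proof.
rewrite (map_comp (fun y : P => y *: 'X) xvar); apply: ser_shifts => j.
by rewrite /tshift big_map.
Qed.

(** By [det_frame], each minor is the Schur function at the shifted times multiplied by a
    Vandermonde determinant that does not depend on [S] and leaves the sum. *)
Lemma wsum_frame L : size L = k ->
  wsum W (frame_vectors L) (plucker_coord scal pi r) =
  tau_poly (tshift L) * \det (Vandermonde k (\row_(a < k) nth 0 (map yvar L) a)).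
Proof.
move=> zL; pose ys := map yvar L; have zys : size ys = k by rewrite size_map.
have zV : size (frame_vectors L) = r by rewrite size_map size_frame zys.
rewrite (@wsum_plucker_coordE _ _ _ _ _ (fun=> 0) _ zV) mulr_suml.
rewrite big_seq_cond [RHS]big_seq_cond; apply: eq_bigr => S.
rewrite mem_words => /andP[/andP[/eqP zS aS] sS].
have bS : bdet (hcoef (tshift L)) S = schur (blam S) (tshift L).
  rewrite -(bdet_schur (tshift L) sS); congr (\det _); apply/matrixP => i j.
  by rewrite !mxE; case: (ltnP (nth 0%N S i) j) => H; rewrite /hsub ?hcompE.
pose hL q : {poly P} := hcoef (tshift L) q *: 'X^q.
have dS : \det (\matrix_(i < r, j < r) ('X^j * ser W hL)`_(nth 0%N S i))
    = schur (blam S) (tshift L) *: 'X^(sumn (blam S)).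
  by rewrite (@det_Xser _ W hL S r zS aS) -bS; exact: bdet_polyX.
rewrite -dS.
rewrite -mulrA -lamL_wshift // zS; congr (_ * _).
have := @det_frame _ W D ys _ _ S (@tshift_hcoef L).
rewrite zys => <- //; last by rewrite /W; lia.
by congr (\det _); apply/matrixP => i j; rewrite !mxE (nth_map 0) ?size_frame ?zys.
Qed.

(** The sign between the differences of [det_Vandermonde] (later minus earlier) and [ydiff] (earlier
    minus later). It depends on [k] alone and disappears from products of two factors. *)
Definition eps : {poly P} := \prod_(a < k) \prod_(b < k | (a < b)%N) -1.

Lemma eps_sqr : eps * eps = 1.
Proof.
rewrite -big_split big1 // => a _; rewrite -big_split big1 // => b _ /=.
by rewrite mulrNN mulr1.
Qed.

Lemma fay_factorE L : size L = k ->
  fay_factor L = eps * wsum W (frame_vectors L) (plucker_coord scal pi r).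
Proof.
move=> zL; rewrite wsum_frame // det_Vandermonde mulrCA /fay_factor mulrC; congr (_ * _).
have -> : eps * \prod_(i < k) \prod_(j < k | (i < j)%N)
    ((\row_(a < k) nth 0 (map yvar L) a) 0 j - (\row_(a < k) nth 0 (map yvar L) a) 0 i)
  = \prod_(a < k) \prod_(b < k | (a < b)%N) ydiff (nth (0 : int) L a) (nth (0 : int) L b).
  rewrite -big_split; apply: eq_bigr => a _; rewrite -big_split; apply: eq_bigr => b _ /=.
  by rewrite !mxE !(nth_map (0 : int)) ?zL // mulN1r opprB.
symmetry; rewrite -zL; apply: prod_sgnL0 => i; first by move=> j; rewrite /ydiff opprB.
exact: subrr.
Qed.

(** The frames of [I] and [J] begin with the same [D] vectors, so the Plucker relation of size
    [D + k] between them keeps only the terms that move a vector attached to an entry of [J]. *)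
Lemma multi_fay I J : (0 < k)%N -> size I = k.-1 -> size J = k.+1 ->
  \sum_(j <- iota 0 k.+1) (-1) ^+ j.+1 *
    (fay_factor (rcons I (nth (0 : int) J j)) * fay_factor (take j J ++ drop j.+1 J)) = 0.
Proof.
move=> k0 zI zJ.
pose us := frame_vectors I; pose vs := frame_vectors J.
have r0W : (0 < r < W)%N by rewrite /r /W; lia.
have zus : size us = r.-1 by rewrite size_map size_frame size_map zI /r; lia.
have zvs : size vs = r.+1 by rewrite size_map size_frame size_map zJ /r; lia.
have Plu := @wsum_plucker_relation _ scal pi W r us vs (fun=> 0) pluckerP r0W zus zvs.
pose f (q : {poly {poly P}}) (B : nat) := (q * ser W (fun q => hcoef tt q *: 'X^q))`_B.
have frameL (L : seq int) : frame_vectors L =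
    [seq f 'X^j | j <- iota 0 D] ++ [seq f ('X^D * geom W (yvar i)) | i <- L].
  by rewrite /frame_vectors /frame map_cat -!map_comp.
have zXs : size [seq f 'X^j | j <- iota 0 D] = D by rewrite size_map size_iota.
have nthL (L : seq int) j : (j < D)%N -> nth (fun=> 0) (frame_vectors L) j = f 'X^j.
  by move=> jD; rewrite frameL nth_cat zXs jD (nth_map 0%N) ?size_iota // nth_iota.
have nthR a : (a < k.+1)%N -> nth (fun=> 0) vs (D + a) =
    f ('X^D * geom W (yvar (nth (0 : int) J a))).
  move=> ak; rewrite /vs frameL nth_cat zXs ltnNge leq_addr /= addKn.
  by rewrite (nth_map (0 : int)) ?zJ.
(* For [j < D] the moved vector already stands at place [j] of [us]. *)
have dup j : (j < D)%N -> wsum W (rcons us (nth (fun=> 0) vs j)) (plucker_coord scal pi r) = 0.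
  move=> jD; have zr : size (rcons us (nth (fun=> 0) vs j)) = r.
    by rewrite size_rcons zus prednK //; case/andP: r0W.
  have jr : (j < r.-1 < r)%N by rewrite /r; lia.
  apply: (@wsum_plucker_coord_dup _ _ _ _ _ (fun=> 0) _ _ _ zr jr).
  by rewrite !nth_rcons zus ltnn eqxx; case/andP: jr => -> _; rewrite !nthL.
have term a : (a < k.+1)%N ->
    fay_factor (rcons I (nth (0 : int) J a)) * fay_factor (take a J ++ drop a.+1 J) =
    wsum W (rcons us (nth (fun=> 0) vs (D + a))) (plucker_coord scal pi r) *
    wsum W (take (D + a) vs ++ drop (D + a).+1 vs) (plucker_coord scal pi r).
  move=> ak; rewrite !fay_factorE ?size_rcons ?zI ?prednK //; last first.
    by rewrite size_cat size_take size_drop zJ ak; lia.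
  rewrite mulrACA eps_sqr mul1r; congr (_ * _); congr (wsum W _ _).
    by rewrite nthR // /us !frameL map_rcons rcons_cat.
  rewrite /vs !frameL map_cat map_take map_drop catA; congr (_ ++ _).
    by rewrite take_cat zXs ltnNge leq_addr /= addKn.
  by rewrite drop_cat zXs -addnS ltnNge leq_addr /= addKn.
move: Plu; rewrite -[in iota _ _]addnS iotaD big_cat add0n.
rewrite big_seq big1 ?Monoid.mul1m; last first.
  by move=> j; rewrite mem_iota add0n => /= jD; rewrite dup // mul0r mulr0.
rewrite -[X in iota X _]addn0 iotaDl big_map => Plu.
(* Passing from the index [D + a] to [a] costs the sign (-1)^D, which is cancelled here. *)
apply: (@lregX _ (-1) D (@lregN _ _ (@lreg1 _))).
rewrite mulr0 -[RHS]Plu mulr_sumr big_seq [RHS]big_seq; apply: eq_bigr => a.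
by rewrite mem_iota add0n => /= ak; rewrite term // mulrA -exprD addnS.
Qed.

End MultiFay.

(** * Frobenius coordinates of the partition of a tuple *)

Section Frobenius.

Lemma conj_partP (m : seq nat) i j : sorted geq m -> (0 < i)%N ->
  (j < count (fun p => i <= p)%N m)%N = (i <= nth 0%N m j)%N.
Proof.
have tr : transitive geq by move=> a b c ab bc; exact: leq_trans bc ab.
move=> + i0; elim: m j => [|a m IH] j sm /=; first by rewrite nth_nil [RHS]leqNgt i0.
have sm' := path_sorted sm.
case: (leqP i a) => ia; first by case: j => [|j] //=; rewrite ?add1n ?ltnS ?IH //.
have H : all (fun p => p < i)%N m.
  move: sm; rewrite /= path_sortedE // => /andP[+ _]; apply: sub_all => b /= ba.
  exact: leq_ltn_trans ba ia.
have -> : count (fun p => i <= p)%N m = 0%N.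
  by apply/eqP; rewrite -leqn0 leqNgt -has_count -all_predC; apply: sub_all H => b /=; rewrite ltnNge.
case: j => [|j] /=; first by rewrite [RHS]leqNgt ia.
case: (ltnP j (size m)) => jm; last by rewrite nth_default // [RHS]leqNgt i0.
by rewrite [RHS]leqNgt (allP H) ?mem_nth.
Qed.

Lemma count_filter_pos (m : seq nat) i : (0 < i)%N ->
  count (fun p => i <= p)%N [seq p <- m | (0 < p)%N] = count (fun p => i <= p)%N m.
Proof.
move=> i0; rewrite count_filter; apply: eq_count => p /=.
by case: (leqP i p) => //= ip; rewrite (leq_trans i0 ip).
Qed.

Lemma initial_segment_sum (p : nat -> bool) n i :
  (forall j, p j.+1 -> p j) -> (forall j, (n <= j)%N -> ~~ p j) ->
  (i < \sum_(j < n) p j)%N = p i.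
Proof.
elim: n p i => [|n IH] p i pS pn; first by rewrite big_ord0 (negbTE (pn i isT)).
rewrite big_ord_recl; case p0: (p 0%N).
  case: i => [|i]; first by rewrite p0.
  rewrite add1n ltnS -(IH (fun j => p j.+1)) // => j; first exact: pS.
  by move=> nj; apply: pn.
have pF j : p j = false by elim: j => // j IHj; apply/negP => /pS; rewrite IHj.
by rewrite big1 // => j _; rewrite pF.
Qed.

Variables (k : nat) (L : seq int).
Hypotheses (uL : uniq L) (zL : size L = k) (geL : all (fun z => - k%:Z <= z) L).

Let L' := sort <=%R L.
(** The entries of [L] in decreasing order. For [i] below the Frobenius rank, [X i] is the
    coordinate a_{i+1}; [m] lists the [k] parts, zeros included. *)
Let X i := nth (0 : int) L' (k - i.+1).
Let m := [seq absz (X i + i.+1%:Z) | i <- iota 0 k].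

Let sL' : sorted <%R L'.
Proof. by rewrite lt_sorted_uniq_le sort_uniq uL sort_sorted //; exact: le_total. Qed.

Let zL' : size L' = k. Proof. by rewrite size_sort. Qed.

Let zm : size m = k. Proof. by rewrite size_map size_iota. Qed.

Let geL' j : (j < k)%N -> - k%:Z + j%:Z <= nth (0 : int) L' j.
Proof.
elim: j => [|j IH] jk.
  rewrite addr0; apply: (allP geL); rewrite -(mem_sort <=%R) mem_nth //.
  by rewrite -/L' zL'.
have := IH (ltnW jk).
have : nth (0 : int) L' j < nth (0 : int) L' j.+1.
  by apply: (sorted_ltn_nth lt_trans) => //; rewrite inE zL' // ltnW.
by move: (nth _ _ j) (nth _ _ j.+1) => a b; lia.
Qed.

Let nth_m i : (i < k)%N -> (nth 0%N m i)%:Z = X i + i.+1%:Z.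
Proof.
move=> ik; rewrite (nth_map 0%N) ?size_iota // nth_iota // add0n.
have := geL' (j := (k - i.+1)%N); rewrite /X; move: (nth _ _ _) => a H.
by have := H ltac:(lia); lia.
Qed.

Let sm : sorted geq m.
Proof.
apply/(sortedP 0%N) => i; rewrite zm => ik /=.
have H : X i.+1 < X i.
  by apply: (sorted_ltn_nth lt_trans) => //; rewrite ?inE ?zL'; lia.
by have := nth_m ik; have := nth_m (ltnW ik); move: H; move: (X i) (X i.+1) => a b; lia.
Qed.

Let lamLE : lamL L = [seq p <- m | (0 < p)%N].
Proof. by rewrite /lamL /m /X /L' zL. Qed.

Let nth_lam i : nth 0%N (lamL L) i = nth 0%N m i.
Proof. by rewrite lamLE nth_filter_pos. Qed.

Let memX z : (z \in L) = (z \in [seq X i | i <- iota 0 k]).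
Proof.
rewrite -(mem_sort <=%R) -/L' -mem_rev; congr (z \in _); rewrite -[in LHS](mkseq_nth (0 : int) L').
by rewrite /mkseq rev_iota_map zL'.
Qed.

Let X_ge0 i : (i < k)%N -> (i.+1 <= nth 0%N m i)%N = (0 <= X i).
Proof. by move=> ik; have := nth_m ik; move: (X i) (nth _ _ _) => a b; lia. Qed.

Let rank_le : (frob_rank (lamL L) <= k)%N.
Proof.
rewrite /frob_rank; apply: leq_trans (_ : \sum_(i < size (lamL L)) 1 <= _)%N.
  by apply: leq_sum => i _; case: ltnP.
rewrite sum_nat_const card_ord muln1 lamLE size_filter -zm; exact: count_size.
Qed.

Let rankP i : (i < frob_rank (lamL L))%N = (i.+1 <= nth 0%N m i)%N.
Proof.
rewrite /frob_rank (initial_segment_sum (p := fun j => (j.+1 <= nth 0%N (lamL L) j)%N)).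
- by rewrite nth_lam.
- move=> j; rewrite !nth_lam => H.
  have jk : (j.+1 < k)%N by rewrite -zm ltnNge; apply/negP => /(nth_default 0%N) E; rewrite E in H.
  have := sortedP 0%N sm j; rewrite zm => /(_ jk) /= H'.
  by apply: leq_trans H'; rewrite ltnW.
- by move=> j jl; rewrite nth_default.
Qed.

Let uXk : uniq [seq X i | i <- iota 0 k].
Proof.
rewrite -rev_iota_map -[X in iota 0 X]zL' -/(mkseq _ _) mkseq_nth rev_uniq.
by rewrite sort_uniq.
Qed.

Let rank_count : frob_rank (lamL L) = count (fun z => 0 <= z) L.
Proof.
have pL : perm_eq L [seq X i | i <- iota 0 k].
  by apply: uniq_perm => // z; rewrite memX.
rewrite (seq.permP pL) count_map -(subnKC rank_le) iotaD count_cat add0n.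
rewrite (@eq_in_count _ _ predT) => [|i]; last first.
  rewrite mem_iota add0n => /= ir.
  by rewrite -X_ge0 ?(leq_trans ir rank_le) // -rankP.
rewrite count_predT size_iota (@eq_in_count _ _ pred0) ?count_pred0 ?addn0 // => i.
rewrite mem_iota subnKC // => /andP[ri ik] /=.
by rewrite -X_ge0 // -rankP ltnNge ri.
Qed.

Let frob_aE i : (i < frob_rank (lamL L))%N -> frob_a (lamL L) i.+1 = X i.
Proof.
move=> ir; rewrite /frob_a /part /= nth_lam nth_m ?addrK //.
exact: leq_trans ir rank_le.
Qed.

(** The value -b_{i+1} - 1, written through the conjugate partition. *)
Let Y i := (i%:Z - (count (fun p => i < p)%N m)%:Z : int).

Let frob_bE i : - frob_b (lamL L) i.+1 - 1 = Y i.
Proof.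
rewrite /frob_b /conj_part lamLE count_filter_pos // /Y.
by move: (count _ _) => c; lia.
Qed.

Let uY : uniq [seq Y i | i <- iota 0 (frob_rank (lamL L))].
Proof.
have Ylt i j : (i < j)%N -> Y i < Y j.
  move=> ij; rewrite /Y; suff : (count (fun p => j < p) m <= count (fun p => i < p) m)%N by lia.
  by apply: sub_count => p /=; apply: leq_ltn_trans; exact: ltnW.
rewrite map_inj_uniq ?iota_uniq // => i j.
by case: (ltngtP i j) => // /Ylt; [move=> + E | move=> + E]; rewrite E ltxx.
Qed.

Let negs := [seq z <- [seq - j.+1%:Z | j <- iota 0 k] | z \notin L].

(** The values [Y i] are distinct and lie in [negs], so a comparison of cardinalities suffices. *)
Let memY : [seq Y i | i <- iota 0 (frob_rank (lamL L))] =i negs.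
Proof.
set r := frob_rank _.
have cm i : (count (fun p => i < p)%N m <= k)%N by rewrite -zm count_size.
apply: (uniq_min_size uY _ _).2.
  move=> z zin; have [i + ->] := mapP zin; rewrite mem_iota add0n => /= ir.
  have iC : (i < count (fun p => i < p)%N m)%N by rewrite conj_partP // -rankP.
  rewrite mem_filter; apply/andP; split.
    (* With c the count in [Y i], [conj_partP] gives [X j > Y i] for j < c and [X j < Y i] for j >=
       c. *)
    rewrite memX; apply/negP => /mapP[j]; rewrite mem_iota add0n => /= jk.
    have := nth_m jk; have := @conj_partP m i.+1 j sm isT; rewrite /Y.
    by move: (count _ _) (X j) (nth 0%N m j) => c x a; lia.
  apply/mapP; exists (count (fun p => i < p)%N m - i.+1)%N.
    by rewrite mem_iota add0n /=; have := cm i; lia.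
  by rewrite /Y; lia.
(* Among the [k] integers of [-k,-1], those missing from [L] are as many as the nonnegative entries
   of [L], because [L] has [k] distinct entries, all at least -k. *)
rewrite size_map size_iota /r rank_count.
set N := [seq - j.+1%:Z | j <- iota 0 k].
have uN : uniq N by rewrite map_inj_uniq ?iota_uniq // => i j; lia.
have E : (size negs + count (mem L) N = k)%N.
  by rewrite /negs size_filter addnC count_predC /N size_map size_iota.
have E1 : count (mem L) N = count (fun z => z < 0) L.
  rewrite -!size_filter; apply: perm_size; apply: uniq_perm; rewrite ?filter_uniq // => z.
  rewrite !mem_filter /= [RHS]andbC; case zL0: (z \in L) => //=.
  apply/mapP/idP => [[j _ ->]|z0]; first by lia.
  have := allP geL z zL0; exists (absz z).-1; last by lia.
  by rewrite mem_iota; lia.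
have E2 : (count (fun z : int => (0 <= z)%R) L + count (fun z : int => (z < 0)%R) L = k)%N.
  by rewrite -zL -(count_predC (fun z : int => 0 <= z)); congr addn; apply: eq_count => z /=; rewrite ltNge.
by move: E E1 E2; move: (size negs) (count _ N) (count _ L) (count _ L) => a b c d; lia.
Qed.

Let uX : uniq [seq X i | i <- iota 0 (frob_rank (lamL L))].
Proof. by have := uXk; rewrite -(subnKC rank_le) iotaD map_cat cat_uniq => /andP[]. Qed.

Let memX_ge0 z : (z \in [seq X i | i <- iota 0 (frob_rank (lamL L))]) = (z \in L) && (0 <= z).
Proof.
rewrite memX; apply/mapP/andP => [[j] | ].
  rewrite mem_iota add0n => /= ir ->.
  have ik := leq_trans ir rank_le.
  by rewrite -X_ge0 // -rankP ir map_f // mem_iota.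
case=> /mapP[j]; rewrite mem_iota add0n => /= ik -> X0.
by exists j => //; rewrite mem_iota /= add0n rankP X_ge0.
Qed.

Let mem_negs z : (z \in negs) = (z \notin L) && (- k%:Z <= z < 0).
Proof.
rewrite mem_filter; case: (z \in L) => //=; apply/mapP/andP => [[j] | [z1 z0]].
  by rewrite mem_iota add0n => /= jk ->; lia.
by exists (absz z).-1; rewrite ?mem_iota; lia.
Qed.

(** The a_i are the nonnegative entries of [L], and the -b_i - 1 are the elements of [-k,-1] missing
    from [L]; on the negative entries of [L] the two indicators cancel. *)
Lemma shift_frobE (n : int -> int) z : shift_frob n (lamL L) z =
  n z - ((- k%:Z <= z < 0)%R : int) + ((z \in L) : int).
Proof.
have cnt (f : nat -> int) r : uniq [seq f i | i <- iota 0 r] ->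
    \sum_(i < r) ((z == f i) : int) = (z \in [seq f i | i <- iota 0 r]).
  elim: r => [|r IH] ; first by rewrite big_ord0.
  rewrite -addn1 iotaD map_cat cat_uniq /= orbF => /and3P[u nf _].
  rewrite addn1 big_ord_recr /= IH // mem_cat inE add0n.
  rewrite add0n in nf; case: eqP nf => [->|_] nf; last by rewrite addr0 orbF.
  by rewrite (negbTE nf) add0r.
rewrite /shift_frob big_add1 /= big_mkord sumrB.
rewrite (eq_bigr (fun i : 'I_(frob_rank (lamL L)) => (z == X i) : int)); last first.
  by move=> i _; rewrite frob_aE.
rewrite [X in _ - X](eq_bigr (fun i : 'I_(frob_rank (lamL L)) => (z == Y i) : int)); last first.
  by move=> i _; rewrite frob_bE.
rewrite !cnt // memX_ge0 memY mem_negs.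
have := allP geL z; case: (z \in L) => /= [/(_ isT)|_]; case: (leP 0 z); lia.
Qed.

End Frobenius.

Lemma coef_linear_diff (F : numFieldType) (A : comAlgType F) (a b : A) d :
  (a *: 'X - b *: 'X)`_d = (if d == 1%N then a else 0) + (-1 : F) *: (if d == 1%N then b else 0).
Proof.
rewrite coefB !coefZ coefX.
by case: eqP => _; rewrite ?mulr1 ?mulr0 ?scaleN1r // oppr0 scaler0.
Qed.

(** * Comparison of graded series with polynomials up to degree [D] *)

Section Agreement.
Variable D : nat.
Implicit Types (F G : PS) (p q : {poly P}).

Definition agree F p := forall d, (d <= D)%N -> F d = p`_d.

Lemma agree_trunc F : agree F (\poly_(d < D.+1) F d).
Proof. by move=> d dD; rewrite coef_poly ltnS dD. Qed.

Lemma agree_mul F G p q : agree F p -> agree G q -> agree (psmul F G) (p * q).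
Proof.
move=> Fp Gq d dD; rewrite coefM /psmul; apply: eq_bigr => i _; rewrite Fp ?Gq //.
  exact: leq_trans (leq_subr _ _) dD.
by apply: leq_trans dD; rewrite -ltnS.
Qed.

Lemma agree_add F G p q : agree F p -> agree G q -> agree (psadd F G) (p + q).
Proof. by move=> Fp Gq d dD; rewrite coefD /psadd Fp ?Gq. Qed.

Lemma agree_one : agree psone 1.
Proof. by move=> d _; rewrite coef1 /psone; case: eqP. Qed.

Lemma agree_zero : agree pszero 0.
Proof. by move=> d _; rewrite coef0. Qed.

Lemma agree_scale_int F p (c : int) : agree F p -> agree (psscale c%:~R F) (c%:~R * p).
Proof. by move=> Fp d dD; rewrite mulrzl coefMrz /psscale scaler_int Fp. Qed.

Lemma agree_diff (u : int * int) : agree (psdiff u) (ydiff u.1 u.2).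
Proof.
by move=> d _; rewrite /ydiff /yvar coef_linear_diff.
Qed.

Lemma agree_exp F p e : agree F p -> agree (psexp F e) (p ^+ e).
Proof.
move=> Fp; elim: e => [|e IH]; first exact: agree_one.
by rewrite exprS; exact: agree_mul.
Qed.

Lemma agree_prod (I : Type) (s : seq I) (F : I -> PS) (p : I -> {poly P}) :
  (forall i, agree (F i) (p i)) -> agree (psprod [seq F i | i <- s]) (\prod_(i <- s) p i).
Proof.
move=> Fp; elim: s => [|i s IH]; first by rewrite big_nil; exact: agree_one.
by rewrite big_cons; exact: agree_mul.
Qed.

Lemma agree_Dprod s : agree (Dprod s) (\prod_(u <- s) ydiff u.1 u.2).
Proof. by apply: agree_prod => u; exact: agree_diff. Qed.

Lemma agree_Dprod_cat a b p q : agree (Dprod a) p -> agree (Dprod b) q ->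
  agree (Dprod (a ++ b)) (p * q).
Proof.
move=> Ha Hb d dD; rewrite (agree_Dprod _ dD) big_cat; apply: (@eqmodXM _ D.+1) => [i iD|i iD|//].
  by rewrite -(agree_Dprod a) // Ha.
by rewrite -(agree_Dprod b) // Hb.
Qed.

End Agreement.

(** * Products over pairs of indices and their exponents *)

Lemma prod_flatten_nseq (R : comNzRingType) (I : Type) (s : seq I) (e : I -> nat) (y : I -> R) :
  \prod_(u <- flatten [seq nseq (e u) u | u <- s]) y u = \prod_(u <- s) y u ^+ e u.
Proof.
elim: s => [|u s IH]; first by rewrite !big_nil.
by rewrite /= big_cat /= IH big_cons big_nseq iter_mulr_1.
Qed.

(** Serves to replace the support list attached to each partition by one common list. *)
Lemma eq_big_support (R : Type) (idx : R) (op : Monoid.com_law idx) (I : eqType)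
    (r1 r2 : seq I) (Q : pred I) (F : I -> R) :
  uniq r1 -> uniq r2 -> (forall i, ~~ Q i -> F i = idx) ->
  (forall i, Q i -> (i \in r1) = (i \in r2)) ->
  \big[op/idx]_(i <- r1) F i = \big[op/idx]_(i <- r2) F i.
Proof.
move=> u1 u2 F1 Qr.
have H r : \big[op/idx]_(i <- r) F i = \big[op/idx]_(i <- [seq i <- r | Q i]) F i.
  by rewrite (bigID Q) /= [X in op _ X]big1 ?Monoid.mulm1 ?big_filter //.
rewrite H [RHS]H; apply: perm_big; apply: uniq_perm; rewrite ?filter_uniq // => i.
by rewrite !mem_filter; case Qi: (Q i) => //=; exact: Qr.
Qed.

Lemma mem_pairs_of U u : (u \in pairs_of U) = [&& u.1 < u.2, u.1 \in U & u.2 \in U].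
Proof.
rewrite mem_filter; congr (_ && _); case: u => i j /=.
apply/allpairsP/andP => [[[a b] /= [+ + [-> ->]]]|[iU jU]]; first by rewrite !mem_undup.
by exists (i, j); rewrite !mem_undup.
Qed.

Lemma pairs_of_uniq U : uniq (pairs_of U).
Proof.
rewrite filter_uniq //; apply: allpairs_uniq; rewrite ?undup_uniq //.
by move=> [a b] [a' b'] _ _ /=.
Qed.

Lemma eq_prod_pairs (R : comNzRingType) (U V : seq int) (m : int -> int) (F : int * int -> R) :
  (forall i, m i != 0 -> (i \in U) && (i \in V)) ->
  (forall u, m u.1 * m u.2 = 0 -> F u = 1) ->
  \prod_(u <- pairs_of U) F u = \prod_(u <- pairs_of V) F u.
Proof.
move=> mUV F1.
apply: (@eq_big_support _ _ _ _ _ _ (fun u => m u.1 * m u.2 != 0)).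
- exact: pairs_of_uniq.
- exact: pairs_of_uniq.
- by move=> u; rewrite negbK => /eqP; exact: F1.
move=> u; rewrite mulf_eq0 negb_or => /andP[/mUV/andP[a b] /mUV/andP[c d]].
by rewrite !mem_pairs_of a b c d.
Qed.

Lemma pairprod_pairs (R : comNzRingType) (g : int -> int -> R) (V L : seq int) :
  uniq L -> {subset L <= V} ->
  pairprod g L = \prod_(u <- pairs_of V) g u.1 u.2 ^+ ((u.1 \in L) * (u.2 \in L)).
Proof.
move=> uL LV.
transitivity (\prod_(u <- pairs_of L) g u.1 u.2 ^+ ((u.1 \in L) * (u.2 \in L))).
  rewrite big_seq (eq_bigr (fun u => g u.1 u.2)); last first.
    by move=> u; rewrite mem_pairs_of => /and3P[_ -> ->].
  rewrite -big_seq /pairs_of undup_id // big_filter big_mkcond big_allpairs_dep.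
  by apply: eq_bigr => i _; rewrite [LHS]big_mkcond.
apply: (@eq_prod_pairs _ _ _ (fun i => (i \in L) : int)).
  by move=> i; case iL: (i \in L) => // _; rewrite LV.
by move=> u; case: (_ \in _); case: (_ \in _).
Qed.

Lemma sum_split_support (A : nmodType) (I : eqType) (r s : seq I) (f g h : I -> A) :
  uniq r -> uniq s -> {subset s <= r} -> (forall z, z \in s -> g z = h z) ->
  (forall z, z \notin s -> g z = 0) ->
  \sum_(z <- r) (f z + g z) = \sum_(z <- r) f z + \sum_(z <- s) h z.
Proof.
move=> ur us sr gh g0; rewrite big_split; congr (_ + _); transitivity (\sum_(z <- s) g z).
  apply: (@eq_big_support _ _ _ _ _ _ (mem s)) => //.
  by move=> z /= zs; rewrite zs sr.
exact: eq_big_seq.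
Qed.

Lemma eq_det_matrix (R : comPzRingType) n (f g : 'I_n -> 'I_n -> R) :
  (forall i j, f i j = g i j) -> \det (\matrix_(i, j) f i j) = \det (\matrix_(i, j) g i j).
Proof. by move=> E; congr (\det _); apply/matrixP => i j; rewrite !mxE. Qed.

Lemma eq_schur l tt ss : tt =1 ss -> schur l tt = schur l ss.
Proof.
move=> E; have H : hz tt =1 hz ss by case=> [q|q]; [apply: eq_hcomp => a; exact: E|].
by rewrite /schur; apply: eq_det_matrix => i j; exact: H.
Qed.

Lemma shift_frob_supp (n : int -> int) (Sn : seq int) l z :
  (forall i, i \notin Sn -> n i = 0) -> z \notin Sn ++ frob_supp l -> shift_frob n l z = 0.
Proof.
move=> hn; rewrite !mem_cat !negb_or => /and3P[/hn nz za zb].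
rewrite /shift_frob nz add0r big_nat big1 // => i ir.
have iin : i \in iota 1 (frob_rank l) by rewrite mem_iota add1n.
have /negbTE -> : z != frob_a l i by apply: contraNneq za => ->; exact: map_f.
by have /negbTE -> : z != - frob_b l i - 1 by apply: contraNneq zb => ->; exact: map_f.
Qed.

(** Here A + B = C + ee + ff, and every integer z satisfies z = |max(0,z)| - |min(0,z)|; adding |C|
    makes the common exponent nonnegative. *)
Lemma exponent_identity (a1 a2 s1 s2 e1 e2 f1 f2 : int) (ee ff : nat) :
  s1 = e1 + f1 -> s2 = e2 + f2 -> e1 * e2 = ee%:Z -> f1 * f2 = ff%:Z ->
  let C := a1 * a2 + a1 * a2 + a1 * s2 + a2 * s1 in
  let A := (a1 + e1) * (a2 + e2) in let B := (a1 + f1) * (a2 + f2) in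
  (absz C + (absz (Num.max 0 A)%R + absz (Num.max 0 B)%R) =
   absz (Num.min 0 A)%R + absz (Num.min 0 B)%R + (absz (C + absz C)%R + (ee + ff)))%N.
Proof.
move=> -> -> Ee Ef C A B.
have H : A + B = C + ee%:Z + ff%:Z by rewrite -Ee -Ef /A /B /C; ring.
by move: C A B H {Ee Ef} => C A B; lia.
Qed.

Lemma prod_expD (R : comNzRingType) (I : Type) (s : seq I) (y : I -> R) (a b : I -> nat) :
  \prod_(u <- s) y u ^+ (a u + b u) = (\prod_(u <- s) y u ^+ a u) * \prod_(u <- s) y u ^+ b u.
Proof. by rewrite -big_split; apply: eq_bigr => u _; rewrite exprD. Qed.

(** * Clearing denominators in the Plucker form of the H-functions *)

Section Assembly.
Variables (pi : seq nat -> CC) (n : int -> int) (Sn : seq int) (k N : nat) (I J : seq int).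
Hypothesis pluckerP : forall k N I J, plucker_ok k N I J -> plucker_C pi I J = 0.
Hypothesis hn : forall i, i \notin Sn -> n i = 0.
Hypothesis okIJ : plucker_ok k N I J.

Let cexp (z : int) : int := n z - ((- k%:Z <= z < 0)%R : int).
Let V : seq int := Sn ++ I ++ J ++ [seq - j.+1%:Z | j <- iota 0 k].
Let tt := shifted_t cexp V.
Let mexp (L : seq int) (z : int) : int := cexp z + ((z \in L) : int).

(** Satisfied by both tuples of every Plucker term with nonzero sign. *)
Let admissible (L : seq int) := [&& uniq L, size L == k, all (in_range k N) L & all (mem (I ++ J)) L].

Let admV L : admissible L -> {subset L <= V}.
Proof.
case/and4P=> _ _ _ /allP sub z /sub /=; rewrite /V !mem_cat.
by case/orP=> ->; rewrite ?orbT.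
Qed.

Let shiftE L z : admissible L -> shift_frob n (lamL L) z = mexp L z.
Proof.
case/and4P=> uL /eqP zL rL _; rewrite (shift_frobE uL zL) // (sub_all _ rL) // => y.
by case/andP.
Qed.

Let mexp_supp L z : admissible L -> mexp L z != 0 ->
  (z \in Sn ++ frob_supp (lamL L)) && (z \in V).
Proof.
move=> aL mz; apply/andP; split.
  by apply: contraNT mz => zU; rewrite -shiftE // (shift_frob_supp hn zU).
apply: contraNT mz => zV.
have zL : z \notin L by apply: contra zV; exact: admV.
move: zV; rewrite /V !mem_cat !negb_or => /and4P[/hn nz _ _ zneg].
rewrite /mexp /cexp nz (negbTE zL) addr0 sub0r.
case: (boolP (- k%:Z <= z < 0)) => // /andP[z1 z2]; case/negP: zneg; apply/mapP.
by exists (absz z).-1; rewrite ?mem_iota; lia.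
Qed.

(** The exponent vector splits as [cexp], absorbed into [tt], plus the indicator of [L], which
    contributes one shift [x_z] for each entry. *)
Let shifted_tE L j : admissible L ->
  shifted_t (shift_frob n (lamL L)) (Sn ++ frob_supp (lamL L)) j = tshift tt L j.
Proof.
move=> aL; have uL : uniq L by case/and4P: aL.
rewrite /tshift /tt /shifted_t -addrA; congr (_ + _).
have scl0 (z : int) : ((0 / j%:R : CC) *: xvar z ^+ j) = 0 by rewrite mul0r scale0r.
transitivity (\sum_(z <- undup V) ((mexp L z)%:~R / j%:R : CC) *: xvar z ^+ j).
  rewrite (eq_bigr (fun z => ((mexp L z)%:~R / j%:R : CC) *: xvar z ^+ j)); last first.
    by move=> z _; rewrite shiftE.
  apply: (@eq_big_support _ _ _ _ _ _ (fun z => mexp L z != 0)); rewrite ?undup_uniq //.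
    by move=> z; rewrite negbK => /eqP ->; exact: scl0.
  by move=> z /(mexp_supp aL)/andP[a b]; rewrite !mem_undup a b.
pose e z : P := (((z \in L) : int)%:~R / j%:R : CC) *: xvar z ^+ j.
have split z : ((mexp L z)%:~R / j%:R : CC) *: xvar z ^+ j =
    ((cexp z)%:~R / j%:R : CC) *: xvar z ^+ j + e z.
  by rewrite /mexp rmorphD /= mulrDl scalerDl.
apply: etrans; first by apply: eq_bigr => z _; exact: split.
apply: (@sum_split_support _ _ _ _ _ e).
- exact: undup_uniq.
- exact: uL.
- by move=> z zL; rewrite mem_undup; exact: admV zL.
- by move=> z zL; rewrite /e zL mul1r.
- by move=> z /negbTE zL; rewrite /e zL; exact: scl0.
Qed.

Let yv (u : int * int) := ydiff u.1 u.2.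
Let posL L (u : int * int) := absz (Num.max 0 (mexp L u.1 * mexp L u.2)).
Let negL L (u : int * int) := absz (Num.min 0 (mexp L u.1 * mexp L u.2)).

Let exp_supp (e : int -> nat) L : admissible L -> e 0 = 0%N ->
  \prod_(u <- pairs_of (Sn ++ frob_supp (lamL L)))
     yv u ^+ e (shift_frob n (lamL L) u.1 * shift_frob n (lamL L) u.2) =
  \prod_(u <- pairs_of V) yv u ^+ e (mexp L u.1 * mexp L u.2).
Proof.
move=> aL e0.
rewrite (eq_bigr (fun u => yv u ^+ e (mexp L u.1 * mexp L u.2))); last first.
  by move=> u _; rewrite !shiftE.
apply: (@eq_prod_pairs _ _ _ (mexp L)); first by move=> z; exact: mexp_supp.
by move=> u ->; rewrite e0 expr0.
Qed.

Let agree_num D L : admissible L ->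
  agree D (fnum (Hnl pi n Sn (lamL L)))
    ((\prod_(u <- pairs_of V) yv u ^+ posL L u) * tau_poly pi D k (tshift tt L)).
Proof.
move=> aL; rewrite -(@exp_supp (fun z => absz (Num.max 0 z)) L) //.
apply: agree_mul; first by apply: agree_prod => u; apply: agree_exp; exact: agree_diff.
move=> d dD; rewrite (coef_tau_poly pi k _ dD) /tau_shift; apply: eq_bigr => f _.
apply: (congr1 (fun x : P => pi (strip f) *: x)).
by apply: eq_schur => j; exact: (shifted_tE j aL).
Qed.

Let agree_den D L : admissible L ->
  agree D (Dprod (fden (Hnl pi n Sn (lamL L)))) (\prod_(u <- pairs_of V) yv u ^+ negL L u).
Proof.
move=> aL; rewrite -(@exp_supp (fun z => absz (Num.min 0 z)) L) //.
rewrite -(@prod_flatten_nseq _ _ (pairs_of _) (fun u => absz (Num.min 0 _)) yv).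
exact: agree_Dprod.
Qed.

(* The part of the exponent of a pair that is common to all Plucker terms. *)
Let Cexp (u : int * int) : int :=
  let s z := (count_mem z (I ++ J))%:Z in
  cexp u.1 * cexp u.2 + cexp u.1 * cexp u.2 + cexp u.1 * s u.2 + cexp u.2 * s u.1.
(** The common exponent may be negative; multiplication by [Q] raises it to
    [Cexp u + absz (Cexp u)], the nonnegative exponent used in [G]. *)
Let Q : {poly P} := \prod_(u <- pairs_of V) yv u ^+ absz (Cexp u).
Let G : {poly P} := \prod_(u <- pairs_of V) yv u ^+ absz (Cexp u + absz (Cexp u)).

Let clear_denominators L1 L2 (T1 T2 : {poly P}) : admissible L1 -> admissible L2 ->
  perm_eq (L1 ++ L2) (I ++ J) ->
  Q * (((\prod_(u <- pairs_of V) yv u ^+ posL L1 u) * T1) *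
       ((\prod_(u <- pairs_of V) yv u ^+ posL L2 u) * T2)) =
  ((\prod_(u <- pairs_of V) yv u ^+ negL L1 u) * (\prod_(u <- pairs_of V) yv u ^+ negL L2 u)) *
  (G * ((pairprod ydiff L1 * T1) * (pairprod ydiff L2 * T2))).
Proof.
move=> a1 a2 pL; have u1 : uniq L1 by case/and4P: a1. have u2 : uniq L2 by case/and4P: a2.
rewrite (pairprod_pairs _ u1 (admV a1)) (pairprod_pairs _ u2 (admV a2)).
have rearr (R : comNzRingType) (q p1 p2 n1 n2 g e f t1 t2 : R) :
    q * (p1 * p2) = n1 * n2 * (g * (e * f)) ->
    q * ((p1 * t1) * (p2 * t2)) = n1 * n2 * (g * ((e * t1) * (f * t2))).
  move=> H; have -> : q * ((p1 * t1) * (p2 * t2)) = q * (p1 * p2) * (t1 * t2) by ring.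
  by rewrite H; ring.
apply: rearr; rewrite /Q /G -!prod_expD; apply: eq_bigr => u _; congr (_ ^+ _).
have cnt z : (count_mem z (I ++ J))%:Z = ((z \in L1) : int) + ((z \in L2) : int).
  by rewrite -(seq.permP pL) count_cat !count_uniq_mem.
apply: exponent_identity; rewrite ?cnt //.
all: by case: (_ \in _); case: (_ \in _).
Qed.

Let L1 j := rcons I (nth (0 : int) J j).
Let L2 j := take j J ++ drop j.+1 J.
Let coeff j : int := (-1) ^+ j.+1 * sgnL (L1 j) * sgnL (L2 j).
Let term j : Defs.frac := fscale (coeff j)%:~R
  (fmul (Hnl pi n Sn (lamL (L1 j))) (Hnl pi n Sn (lamL (L2 j)))).
Let val D j : {poly P} :=
  (-1) ^+ j.+1 * (fay_factor pi D k tt (L1 j) * fay_factor pi D k tt (L2 j)).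

(** Says without division that the term equals [G / Q] times a multi-Fay term; [Q] and [G] are the
    same for all [j]. *)
Let term_plucker D j : (j < k.+1)%N -> exists N1 D1,
  [/\ agree D (fnum (term j)) N1, agree D (Dprod (fden (term j))) D1 & Q * N1 = D1 * (G * val D j)].
Proof.
move=> jk; have /and5P[k0 kN /eqP zI /eqP zJ /andP[rI rJ]] := okIJ.
have jJ : (j < size J)%N by rewrite zJ.
have [u12|u12] := boolP (uniq (L1 j) && uniq (L2 j)); last first.
  have c0 : sgnL (L1 j) * sgnL (L2 j) = 0.
    by rewrite /sgnL; move: u12; case: (uniq _); case: (uniq _) => //= _; rewrite ?mul0r ?mulr0.
  have v0 : val D j = 0.
    rewrite /val /fay_factor.
    have rearr (R : comNzRingType) (c s1 s2 p1 t1 p2 t2 : R) : s1 * s2 = 0 ->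
        c * (s1 * p1 * t1 * (s2 * p2 * t2)) = 0.
      move=> s0; have -> : c * (s1 * p1 * t1 * (s2 * p2 * t2)) = s1 * s2 * (c * p1 * t1 * p2 * t2).
        by ring.
      by rewrite s0 mul0r.
    by apply: rearr; rewrite -intrM c0.
  (* A tuple has a repetition, so the coefficient is 0; the witness keeps this factor to fit
     [agree_scale_int]. *)
  exists (0%:~R * \poly_(d < D.+1)
    fnum (fmul (Hnl pi n Sn (lamL (L1 j))) (Hnl pi n Sn (lamL (L2 j)))) d).
  exists (\prod_(u <- fden (term j)) ydiff u.1 u.2); split; last by rewrite v0 !mulr0 mul0r mulr0.
    rewrite /term /coeff -mulrA c0 mulr0; apply: agree_scale_int; exact: agree_trunc.
  exact: agree_Dprod.
have pJ : perm_eq (nth (0 : int) J j :: L2 j) J.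
  by rewrite -[X in perm_eq _ X](cat_take_drop j J) (drop_nth (0 : int) jJ) perm_sym -[_ :: drop _ _]cat1s perm_catCA.
have p12 : perm_eq (L1 j ++ L2 j) (I ++ J).
  by rewrite /L1 cat_rcons perm_cat2l.
have rng z : z \in I ++ J -> in_range k N z.
  by rewrite mem_cat => /orP[/(allP rI)|/(allP rJ)].
have [u1 u2] := andP u12.
have sub1 z : z \in L1 j -> z \in I ++ J by rewrite -(perm_mem p12) mem_cat => ->.
have sub2 z : z \in L2 j -> z \in I ++ J by move=> zL; rewrite -(perm_mem p12) mem_cat zL orbT.
have a1 : admissible (L1 j).
  apply/and4P; split=> //; first by rewrite size_rcons zI prednK.
    by apply/allP => z /sub1/rng.
  by apply/allP => z /sub1.
have a2 : admissible (L2 j).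
  apply/and4P; split=> //.
  - by have := perm_size pJ; rewrite zJ => -[->].
  - by apply/allP => z /sub2/rng.
  - by apply/allP => z /sub2.
exists ((coeff j)%:~R *
  (((\prod_(u <- pairs_of V) yv u ^+ posL (L1 j) u) * tau_poly pi D k (tshift tt (L1 j))) *
   ((\prod_(u <- pairs_of V) yv u ^+ posL (L2 j) u) * tau_poly pi D k (tshift tt (L2 j))))).
exists ((\prod_(u <- pairs_of V) yv u ^+ negL (L1 j) u) *
        (\prod_(u <- pairs_of V) yv u ^+ negL (L2 j) u)).
split.
- exact (agree_scale_int _ (agree_mul (@agree_num D _ a1) (@agree_num D _ a2))).
- exact (agree_Dprod_cat (@agree_den D _ a1) (@agree_den D _ a2)).
rewrite mulrCA (clear_denominators _ _ a1 a2 p12) /val /fay_factor /coeff !rmorphM rmorphXn rmorphN1 /=.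
have rearr (R : comNzRingType) (c s1 s2 d g p1 t1 p2 t2 : R) :
    c * s1 * s2 * (d * (g * ((p1 * t1) * (p2 * t2)))) =
    d * (g * (c * (s1 * p1 * t1 * (s2 * p2 * t2)))) by ring.
exact: rearr.
Qed.

(** The relation [Q * N1 = D1 * (G * v)] is stable under the addition of fractions. *)
Let foldr_plucker D (js : seq nat) : all (fun j => j < k.+1)%N js -> exists N1 D1,
  [/\ agree D (fnum (foldr (fun j acc => fadd (term j) acc) fzero_el js)) N1,
      agree D (Dprod (fden (foldr (fun j acc => fadd (term j) acc) fzero_el js))) D1 &
      Q * N1 = D1 * (G * \sum_(j <- js) val D j)].
Proof.
elim: js => [_|j js IH /= /andP[jk /IH[N2 [D2 [aN2 aD2 E2]]]]].
  exists 0, 1; split; [exact: agree_zero|exact: agree_one|by rewrite big_nil !mulr0].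
have [N1 [D1 [aN1 aD1 E1]]] := term_plucker D jk.
exists (N1 * D2 + N2 * D1), (D1 * D2); split.
- by apply: agree_add; apply: agree_mul.
- exact: agree_Dprod_cat.
have rearr (R : comNzRingType) (q m1 m2 e1 e2 g v1 v2 : R) :
    q * m1 = e1 * (g * v1) -> q * m2 = e2 * (g * v2) ->
    q * (m1 * e2 + m2 * e1) = e1 * e2 * (g * (v1 + v2)).
  move=> H1 H2; have -> : q * (m1 * e2 + m2 * e1) = (q * m1) * e2 + (q * m2) * e1 by ring.
  by rewrite H1 H2; ring.
by rewrite big_cons; exact: rearr.
Qed.

Lemma fzero_plucker_H : fzero (plucker_H pi n Sn I J).
Proof.
(* The multiplier is the series form of [Q]; it does not depend on the degree. *)
exists (flatten [seq nseq (absz (Cexp u)) u | u <- pairs_of V]); split.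
  apply/allP => u /flattenP[s /mapP[v vV ->]]; rewrite mem_nseq => /andP[_ /eqP ->].
  by move: vV; rewrite mem_pairs_of => /andP[/lt_eqF -> _].
(* The component of degree [D] is computed in the truncation of order [D], where [multi_fay] makes
   it vanish. *)
move=> D; have /and5P[k0 _ /eqP zI /eqP zJ _] := okIJ.
have all_k : all (fun j => j < k.+1)%N (iota 0 k.+1).
  by apply/allP => j; rewrite mem_iota add0n.
have [N1 [D1 [aN1 _ E1]]] := foldr_plucker D all_k.
have E : plucker_H pi n Sn I J = foldr (fun j acc => fadd (term j) acc) fzero_el (iota 0 k.+1).
  by rewrite /plucker_H /plucker_terms zJ foldr_map.
have aQ := @agree_Dprod D (flatten [seq nseq (absz (Cexp u)) u | u <- pairs_of V]).
rewrite prod_flatten_nseq in aQ.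
rewrite E (agree_mul aQ aN1 (leqnn D)) -/Q E1.
have -> : \sum_(j <- iota 0 k.+1) val D j = 0 by exact: multi_fay.
by rewrite !mulr0 coef0.
Qed.

End Assembly.

Theorem mainTheorem5 (pi : seq nat -> CC) (hw : is_point pi)
    (n : int -> int) (Sn : seq int) (hn : forall i, i \notin Sn -> n i = 0%R)
    (k N : nat) (I J : seq int) :
  plucker_ok k N I J -> fzero (plucker_H pi n Sn I J).
Proof. by case: hw => _ pluckerP; exact: fzero_plucker_H. Qed.
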